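(* Let $\delta_0=\frac14-\frac{2}{\pi^2}$. For every $\epsilon>0$ there exists $x_0$ such that for all $x>x_0$ the following holds. Let $A\subseteq[1,x]\cap\mathbb{N}$ be a set of integers such that $A+A$ contains no squarefree integer, and suppose $|A|>(\delta_0+\epsilon)x$. Then either $A$ is a subset of $4\mathbb{N}$, of $9\mathbb{N}$, or of $4\mathbb{N}+2$, or all elements of $A$ are even and there exists $a\in\{1,\ldots,8\}$ such that for every $n\in A$: $n\equiv 2\pmod 4 \iff n\equiv a\pmod 9$, and $n\equiv 0\pmod 4\iff n\equiv -a\pmod 9$.
   Context: $A+A=\{a+b: a,b\in A\}$. For a positive integer $m$ and an integer $r$, $m\mathbb{N}+r$ denotes the set of positive integers congruent to $r$ modulo $m$. *)

(* Defs.v *)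
From Stdlib Require Export Reals List Arith.
Export ListNotations.
Open Scope R_scope.

Definition delta0 : R := / 4 - 2 / (PI ^ 2).

(** n is squarefree: no square d^2 with d > 1 divides n
    (so 0 is not squarefree). *)
Definition squarefree (n : nat) : Prop :=
  forall d : nat, Nat.divide (d * d) n -> d = 1%nat.

Definition sumset_no_squarefree (A : list nat) : Prop :=
  forall a b : nat, In a A -> In b A -> ~ squarefree (a + b).

(* Main.v *)
Require Import Defs.
From Stdlib Require Import Reals List Arith.
From Stdlib Require Import ZArith Znumtheory Lia Lra Classical ClassicalEpsilon.
Open Scope R_scope.

(* Split A by residues modulo 4. A sum of elements of classes i and j with
   i + j <> 0 mod 4 is never divisible by 4, so it is divisible by the square of
   an odd prime. One element b thus confines each class compatible with it to the
   n such that n + b has an odd square factor, of relative density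
   eta = 1 - 8 / pi^2 inside the class, and delta0 = eta / 4. The exact value only
   needs sum 1/d^2 <= pi^2/8 over odd d, since every integer is d^2 s with d odd
   and s free of odd squares.

   Two elements b, b' that differ modulo 9 confine a class much further, and more
   so if they also differ modulo 25 or 49. If the residues modulo 9 of a class and
   of its neighbours always cancel, A is structured or small; otherwise A is small
   unless one class, 0 or 2 modulo 4, is large while all other elements are
   congruent modulo 9. In that last case, for the least prime q such that the others
   meet two residues modulo q^2, those others have density O(1 / prod_{p<q} p^2),
   which is less than the loss, of order 1 / q^2, of the large class. *)

(** * Counting sets of integers *)

(** One case has no numerical room. The set made of 2 and of the multiples n of 4 for which n + 2
    has an odd square factor has no squarefree sum, is not structured once x is large, and has
    asymptotic density exactly eta / 4. For a large even class with few other elements, the loss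
    caused by a second residue must therefore dominate the gain for each prime q separately; only a
    remainder of order 1 / Q0^2, at a cutoff Q0, is charged to epsilon.

    Every other unstructured configuration stays below the total relative density 0.1867 <= eta,
    which needs only a few sums over primes to four digits. The tightest one has four classes of
    density 0.04666 each. This is why three neighbours are compared modulo 9, 25 and 49: two
    neighbours that differ modulo 9 give only 0.0921, and four such classes would exceed eta.

    Sums of two elements are at most 2x, so every sieve stops near sqrt(2x) and its error is O(sqrt
    x). *)

Definition card_le (P : nat -> Prop) (b : R) : Prop :=
  forall l, NoDup l -> (forall n, In n l -> P n) -> INR (length l) <= b.

Definition rsum {B : Type} (f : B -> R) (l : list B) : R :=
  fold_right (fun d s => f d + s) 0 l.

Definition classicb (P : Prop) : bool :=
  if excluded_middle_informative P then true else false.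

Lemma classicb_true (P : Prop) : classicb P = true <-> P.
Proof. unfold classicb; destruct (excluded_middle_informative P); intuition congruence. Qed.

Lemma classicb_false (P : Prop) : classicb P = false <-> ~ P.
Proof. unfold classicb; destruct (excluded_middle_informative P); intuition congruence. Qed.

Lemma filter_length_compl {B : Type} (f : B -> bool) (l : list B) :
  (length (filter f l) + length (filter (fun n => negb (f n)) l) = length l)%nat.
Proof. induction l as [|a l IH]; simpl; auto. destruct (f a); simpl; lia. Qed.

Lemma card_le_mono (P Q : nat -> Prop) (b c : R) :
  card_le P b -> (forall n, Q n -> P n) -> b <= c -> card_le Q c.
Proof. intros H HPQ Hbc l Hl Hin. apply Rle_trans with b; auto. Qed.

Lemma card_le_empty (P : nat -> Prop) : (forall n, ~ P n) -> card_le P 0.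
Proof.
  intros H [|a l] Hl Hin; simpl; [lra|].
  exfalso; apply (H a), Hin; now left.
Qed.

Lemma card_le_union (P Q : nat -> Prop) (b c : R) :
  card_le P b -> card_le Q c -> card_le (fun n => P n \/ Q n) (b + c).
Proof.
  intros HP HQ l Hl Hin.
  rewrite <- (filter_length_compl (fun n => classicb (P n)) l), plus_INR.
  apply Rplus_le_compat.
  - apply HP; [now apply NoDup_filter|].
    intros n Hn. apply filter_In in Hn. now apply classicb_true.
  - apply HQ; [now apply NoDup_filter|].
    intros n Hn. apply filter_In in Hn. destruct Hn as [Hn Hb].
    apply Bool.negb_true_iff, classicb_false in Hb.
    destruct (Hin n Hn); tauto.
Qed.

Lemma card_le_Union {B : Type} (P : B -> nat -> Prop) (f : B -> R) (l : list B) :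
  (forall i, In i l -> card_le (P i) (f i)) ->
  card_le (fun n => exists i, In i l /\ P i n) (rsum f l).
Proof.
  induction l as [|a l IH]; intros H.
  - simpl. apply card_le_empty. now intros n [i [[] _]].
  - simpl. eapply card_le_mono with (b := f a + rsum f l);
      [apply (card_le_union (P a) (fun n => exists i, In i l /\ P i n))| |lra].
    + apply H; now left.
    + apply IH. intros i Hi; apply H; now right.
    + intros n [i [[<-|Hi] Hn]]; [now left|right; eauto].
Qed.

Lemma rsum_const {B : Type} (c : R) (l : list B) :
  rsum (fun _ => c) l = INR (length l) * c.
Proof. induction l as [|a l IH]; [simpl; lra|]. cbn [rsum fold_right length] in *. fold (rsum (fun _ : B => c) l). rewrite S_INR, IH. lra. Qed.

Lemma rsum_affine {B : Type} (f : B -> R) (a b : R) (l : list B) :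
  rsum (fun i => a * f i + b) l = a * rsum f l + INR (length l) * b.
Proof.
  induction l as [|i l IH]; [simpl; lra|].
  cbn [rsum fold_right length] in *. fold (rsum f l).
  fold (rsum (fun i : B => a * f i + b) l). rewrite S_INR, IH. lra.
Qed.

Lemma rsum_le {B : Type} (f g : B -> R) (l : list B) :
  (forall i, In i l -> f i <= g i) -> rsum f l <= rsum g l.
Proof.
  induction l as [|i l IH]; intros H; simpl; [lra|].
  apply Rplus_le_compat; [apply H; now left|apply IH; intros; apply H; now right].
Qed.

Lemma rsum_app {B : Type} (f : B -> R) (l l' : list B) :
  rsum f (l ++ l') = rsum f l + rsum f l'.
Proof. induction l as [|i l IH]; simpl; [lra|]. rewrite IH. lra. Qed.

(** Division by [g] is injective on a set with gaps at least [g], and its values lie between 0 and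
    [x / g]; the [+ 1] accounts for the value 0. *)
Lemma card_le_sep (P : nat -> Prop) (x : R) (g : nat) :
  (0 < g)%nat -> 0 <= x ->
  (forall n, P n -> INR n <= x) ->
  (forall n n', P n -> P n' -> (n < n')%nat -> (n + g <= n')%nat) ->
  card_le P (x / INR g + 1).
Proof.
  intros Hg Hx Hb Hsep l Hl Hin.
  assert (Hg' : 0 < INR g) by now apply lt_0_INR.
  set (N := Z.to_nat (Int_part x)).
  destruct (base_Int_part x) as [B1 B2].
  assert (HN0 : (0 <= Int_part x)%Z).
  { apply Znot_gt_le; intros H.
    assert (Int_part x <= -1)%Z by lia. apply IZR_le in H0. lra. }
  assert (HN : INR N <= x).
  { unfold N. rewrite INR_IZR_INZ, Z2Nat.id; auto. }
  assert (HN' : forall n, INR n <= x -> (n <= N)%nat).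
  { intros n Hn. unfold N. rewrite INR_IZR_INZ in Hn.
    assert (IZR (Z.of_nat n) < IZR (Int_part x + 1)) by (rewrite plus_IZR; lra).
    apply lt_IZR in H. lia. }
  assert (Hlen : (length l <= S (N / g))%nat).
  { rewrite <- (length_map (fun n => n / g)%nat l), <- (length_seq (S (N / g)) 0).
    apply NoDup_incl_length.
    - apply NoDup_map_NoDup_ForallPairs; auto.
      intros n n' Hn Hn' Heq.
      destruct (Nat.lt_trichotomy n n') as [H|[H|H]]; auto; exfalso.
      + pose proof (Hsep n n' (Hin _ Hn) (Hin _ Hn') H) as H'.
        apply (Nat.Div0.div_le_mono _ _ g) in H'.
        replace (n + g)%nat with (n + 1 * g)%nat in H' by lia.
        rewrite Nat.div_add in H'; lia.
      + pose proof (Hsep n' n (Hin _ Hn') (Hin _ Hn) H) as H'.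
        apply (Nat.Div0.div_le_mono _ _ g) in H'.
        replace (n' + g)%nat with (n' + 1 * g)%nat in H' by lia.
        rewrite Nat.div_add in H'; lia.
    - intros k Hk. apply in_map_iff in Hk. destruct Hk as [n [<- Hn]].
      apply in_seq. assert (n / g <= N / g)%nat; [|lia].
      apply Nat.Div0.div_le_mono, HN', Hb, Hin, Hn. }
  apply le_INR in Hlen. rewrite S_INR in Hlen.
  assert (INR (N / g) <= x / INR g); [|lra].
  apply Rmult_le_reg_r with (INR g); auto.
  unfold Rdiv. rewrite Rmult_assoc, Rinv_l, Rmult_1_r by lra.
  rewrite <- mult_INR. apply Rle_trans with (INR N); auto.
  apply le_INR. rewrite Nat.mul_comm. apply Nat.Div0.mul_div_le.
Qed.

Lemma card_le_cong (P : nat -> Prop) (x : R) (g : nat) :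
  (0 < g)%nat -> 0 <= x ->
  (forall n, P n -> INR n <= x) ->
  (forall n n', P n -> P n' -> (Z.of_nat g | Z.of_nat n - Z.of_nat n')%Z) ->
  card_le P (x / INR g + 1).
Proof.
  intros Hg Hx Hb Hc. apply card_le_sep; auto.
  intros n n' Hn Hn' Hlt. pose proof (Hc n' n Hn' Hn) as H.
  apply Z.divide_pos_le in H; lia.
Qed.

Lemma rel_prime_mul_divide (a b z : Z) :
  rel_prime a b -> (a | z)%Z -> (b | z)%Z -> (a * b | z)%Z.
Proof.
  intros Hab [k ->] Hb.
  rewrite Z.mul_comm in Hb |- *. rewrite (Z.mul_comm k a).
  apply Gauss in Hb; [|now apply rel_prime_sym].
  rewrite (Z.mul_comm b a). now apply Z.mul_divide_mono_l.
Qed.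

Definition inv_sq (d : nat) : R := / (INR d * INR d).

(* [a] may depend on the residue of [n] modulo [m]: each residue class modulo
   [m] is sieved with its own shift. *)
Lemma card_le_sieve (P : nat -> Prop) (x : R) (k m : nat) (a : nat -> nat) (L : list nat) :
  0 <= x -> (0 < k)%nat -> (0 < m)%nat ->
  (forall n, P n -> INR n <= x) ->
  (forall n n', P n -> P n' -> (Z.of_nat k | Z.of_nat n - Z.of_nat n')%Z) ->
  rel_prime (Z.of_nat k) (Z.of_nat m) ->
  (forall d, In d L -> (0 < d)%nat /\ rel_prime (Z.of_nat k) (Z.of_nat d) /\
     rel_prime (Z.of_nat m) (Z.of_nat d)) ->
  (forall n, P n -> exists d, In d L /\
     (Z.of_nat (d * d) | Z.of_nat n + Z.of_nat (a (n mod m)%nat))%Z) ->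
  card_le P (x / INR k * rsum inv_sq L + INR (length L) * INR m).
Proof.
  intros Hx Hk Hm Hb Hc Hkm HL HP.
  rewrite <- rsum_affine.
  (* By the Chinese remainder theorem a pair [d], [s] leaves one class modulo [k * m * d^2], hence
     at most [x / (k m d^2) + 1] elements. Over the [m] residues [s] the main terms add up to
     [x / (k d^2)], so [m] enters only the error. *)
  eapply card_le_mono with
    (P := fun n => exists d, In d L /\
       exists s, In s (seq 0 m) /\ (P n /\ (n mod m)%nat = s /\
         (Z.of_nat (d * d) | Z.of_nat n + Z.of_nat (a s))%Z));
    [apply card_le_Union | | apply Rle_refl].
  2:{ intros n Hn. destruct (HP n Hn) as [d [Hd Hdiv]].
      exists d; split; auto. exists (n mod m)%nat. repeat split; auto.
      apply in_seq. pose proof (Nat.mod_upper_bound n m). lia. }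
  intros d Hd. destruct (HL d Hd) as [Hd0 [Hkd Hmd]].
  assert (Hk' : 0 < INR k) by now apply lt_0_INR.
  assert (Hm' : 0 < INR m) by now apply lt_0_INR.
  assert (Hd' : 0 < INR d) by now apply lt_0_INR.
  eapply card_le_mono with (b := rsum (fun _ : nat => x / INR (k * m * (d * d)) + 1) (seq 0 m));
    [apply card_le_Union | intros n Hn; exact Hn |].
  2:{ rewrite rsum_const, length_seq, !mult_INR. unfold inv_sq.
      apply Req_le. field. lra. }
  intros s Hs. apply card_le_cong; auto.
  - repeat apply Nat.mul_pos_pos; auto.
  - now intros n [Hn _]; apply Hb.
  - intros n n' [Hn [Hs1 Hd1]] [Hn' [Hs2 Hd2]].
    rewrite !Nat2Z.inj_mul in *.
    assert (Hmk : (Z.of_nat m | Z.of_nat n - Z.of_nat n')%Z).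
    { rewrite (Nat.div_mod_eq n m), (Nat.div_mod_eq n' m), Hs1, Hs2.
      exists (Z.of_nat (n / m) - Z.of_nat (n' / m))%Z. lia. }
    apply rel_prime_mul_divide.
    + apply rel_prime_mult; apply rel_prime_sym; apply rel_prime_mult;
        now apply rel_prime_sym.
    + apply rel_prime_mul_divide; auto.
    + replace (Z.of_nat n - Z.of_nat n')%Z
        with ((Z.of_nat n + Z.of_nat (a s)) - (Z.of_nat n' + Z.of_nat (a s)))%Z by lia.
      now apply Z.divide_sub_r.
Qed.

(** * Sums of inverse squares *)

Lemma rsum_map {B C : Type} (f : C -> R) (h : B -> C) (l : list B) :
  rsum f (map h l) = rsum (fun i => f (h i)) l.
Proof. induction l as [|i l IH]; simpl; [reflexivity|]. now rewrite IH. Qed.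

Lemma rsum_plus {B : Type} (f g : B -> R) (l : list B) :
  rsum (fun i => f i + g i) l = rsum f l + rsum g l.
Proof. induction l as [|i l IH]; simpl; [lra|]. rewrite IH. lra. Qed.

Lemma rsum_ext {B : Type} (f g : B -> R) (l : list B) :
  (forall i, In i l -> f i = g i) -> rsum f l = rsum g l.
Proof.
  intros H; apply Rle_antisym; apply rsum_le; intros i Hi; rewrite (H i Hi); lra.
Qed.

Lemma rsum_incl {B : Type} (f : B -> R) (l l' : list B) :
  (forall i, 0 <= f i) -> NoDup l -> incl l l' -> rsum f l <= rsum f l'.
Proof.
  intros Hf. revert l'. induction l as [|a l IH]; intros l' Hl Hi.
  - simpl. clear -Hf. induction l' as [|b l' IH']; simpl; [lra|]. pose proof (Hf b). lra.
  - inversion_clear Hl.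
    destruct (in_split a l') as [l1 [l2 ->]]; [apply Hi; now left|].
    rewrite rsum_app. simpl.
    assert (rsum f l <= rsum f (l1 ++ l2)); [|rewrite rsum_app in *; lra].
    apply IH; auto. intros b Hb.
    specialize (Hi b (or_intror Hb)). apply in_app_iff in Hi. apply in_app_iff.
    destruct Hi as [Hi|[->|Hi]]; auto. contradiction.
Qed.

Lemma rsum_seq_rev (f : nat -> R) (N : nat) :
  rsum f (seq 0 N) = rsum (fun k => f (N - 1 - k)%nat) (seq 0 N).
Proof.
  induction N as [|N IH]; [reflexivity|].
  rewrite seq_S, rsum_app, IH at 1. simpl.
  rewrite <- seq_shift, rsum_map. rewrite Rplus_0_r, Rplus_comm.
  f_equal; [f_equal; lia|]. apply rsum_ext. intros i _. f_equal. lia.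
Qed.

Lemma map_add_seq (m s N : nat) : map (fun k => m + k)%nat (seq s N) = seq (m + s) N.
Proof.
  revert s. induction N as [|N IH]; intros s; simpl; auto.
  rewrite IH. do 2 f_equal. lia.
Qed.

(** The identity behind the elementary proof that the inverse squares of the odd numbers sum to pi^2
    / 8: it reduces a sum over 2^(n+1) angles to 4 times a sum over 2^n angles. *)
Lemma inv_sin_sqr_double (t : R) : sin t <> 0 -> cos t <> 0 ->
  / (sin t)^2 + / (sin (PI / 2 - t))^2 = 4 * / (sin (2 * t))^2.
Proof.
  intros Hs Hc. rewrite sin_shift, sin_2a.
  replace (/ sin t ^ 2 + / cos t ^ 2)
    with (((sin t)² + (cos t)²) / ((sin t)^2 * (cos t)^2)) by (unfold Rsqr; field; auto).
  rewrite sin2_cos2. field. auto.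
Qed.

Definition odd_angle (n k : nat) : R := INR (2 * k + 1) * PI / (4 * 2 ^ n).

Lemma odd_angle_bounds (n k : nat) : (k < 2 ^ n)%nat ->
  0 < odd_angle n k < PI / 2.
Proof.
  intros Hk. unfold odd_angle. pose proof PI_RGT_0.
  assert (0 < 2 ^ n) by (apply pow_lt; lra).
  assert (INR (2 * k + 1) < 2 * 2 ^ n).
  { replace (2 * 2 ^ n) with (INR (2 * 2 ^ n)) by (rewrite mult_INR, pow_INR; change (INR 2) with 2; lra).
    apply lt_INR. lia. }
  assert (0 < INR (2 * k + 1)) by (apply lt_0_INR; lia).
  split.
  - apply Rdiv_lt_0_compat; nra.
  - apply Rmult_lt_reg_r with (4 * 2 ^ n); [lra|].
    unfold Rdiv. rewrite Rmult_assoc, Rinv_l by lra. nra.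
Qed.

(* The angles of step [n + 1] are the [t / 2] and [PI / 2 - t / 2], for [t] an
   angle of step [n]. *)
Lemma sum_inv_sin_sqr (n : nat) :
  rsum (fun k => / (sin (odd_angle n k))^2) (seq 0 (2 ^ n)) = 2 * (2 ^ n * 2 ^ n).
Proof.
  induction n as [|n IH].
  - simpl. unfold odd_angle.
    replace (INR (2 * 0 + 1) * PI / (4 * 2 ^ 0)) with (PI / 4) by (simpl; field).
    rewrite sin_PI4. pose proof Rlt_sqrt2_0.
    assert (sqrt 2 * sqrt 2 = 2) by (apply sqrt_sqrt; lra).
    replace (1 / sqrt 2 * (1 / sqrt 2 * 1)) with (/ (sqrt 2 * sqrt 2)) by (field; lra).
    rewrite H0. field.
  - replace (2 ^ S n)%nat with (2 ^ n + 2 ^ n)%nat by (simpl; lia).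
    rewrite seq_app, rsum_app. simpl (0 + 2 ^ n)%nat.
    replace (seq (2 ^ n) (2 ^ n)) with (map (fun k => 2 ^ n + k)%nat (seq 0 (2 ^ n))).
    2:{ rewrite map_add_seq. f_equal. lia. }
    (* Reversing the upper half pairs [k] with [2^(n+1) - 1 - k], whose angle is [PI / 2] minus that
       of [k]. *)
    rewrite rsum_map, (rsum_seq_rev (fun i => / sin (odd_angle (S n) (2 ^ n + i)) ^ 2)).
    rewrite <- rsum_plus.
    rewrite (rsum_ext _ (fun k => 4 * / (sin (odd_angle n k))^2 + 0)).
    + rewrite rsum_affine, IH. simpl. ring.
    + intros k Hk. apply in_seq in Hk. rewrite Rplus_0_r.
      pose proof (odd_angle_bounds n k ltac:(lia)) as Hb.
      assert (0 < 2 ^ n) by (apply pow_lt; lra).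
      replace (odd_angle n k) with (2 * odd_angle (S n) k) in *
        by (unfold odd_angle; simpl; field; lra).
      rewrite <- inv_sin_sqr_double.
      * do 4 f_equal. unfold odd_angle.
        replace (INR (2 * (2 ^ n + (2 ^ n - 1 - k)) + 1)) with (4 * 2 ^ n - INR (2 * k + 1)).
        { simpl. field. lra. }
        replace (2 * (2 ^ n + (2 ^ n - 1 - k)) + 1)%nat with (4 * 2 ^ n - (2 * k + 1))%nat by lia.
        rewrite minus_INR, (mult_INR 4), pow_INR by lia.
        change (INR 2) with 2. change (INR 4) with (1 + 1 + 1 + 1). lra.
      * apply Rgt_not_eq, sin_gt_0; lra.
      * apply Rgt_not_eq, cos_gt_0; lra.
Qed.

Lemma inv_sq_nonneg (d : nat) : 0 <= inv_sq d.
Proof.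
  unfold inv_sq. destruct d; [simpl; rewrite Rmult_0_l, Rinv_0; lra|].
  left. apply Rinv_0_lt_compat, Rmult_lt_0_compat; apply lt_0_INR; lia.
Qed.

(** Since [sin t < t], each [1 / t^2] is at most [1 / sin^2 t]. For [t = (2k+1) pi / 2^(n+2)] the
    former is [16 * 4^n / pi^2] times [1 / (2k+1)^2], while the latter sum to [2 * 4^n]; the powers
    of 4 cancel. *)
Lemma sum_odd_inv_sq_pow2 (n : nat) :
  rsum (fun k => inv_sq (2 * k + 1)) (seq 0 (2 ^ n)) <= PI ^ 2 / 8.
Proof.
  pose proof PI_RGT_0.
  assert (H2 : 0 < 2 ^ n) by (apply pow_lt; lra).
  assert (H8 : rsum (fun k => 16 * (2 ^ n * 2 ^ n) / PI ^ 2 * inv_sq (2 * k + 1) + 0)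
             (seq 0 (2 ^ n)) <= 2 * (2 ^ n * 2 ^ n)).
  { rewrite <- sum_inv_sin_sqr. apply rsum_le. intros k Hk. apply in_seq in Hk.
    pose proof (odd_angle_bounds n k ltac:(lia)) as Hb.
    assert (0 < INR (2 * k + 1)) by (apply lt_0_INR; lia).
    apply Rle_trans with (/ (odd_angle n k) ^ 2).
    - right. unfold odd_angle, inv_sq. field. lra.
    - assert (0 < sin (odd_angle n k)) by (apply sin_gt_0; lra).
      assert (sin (odd_angle n k) < odd_angle n k) by (apply sin_lt_x; lra).
      apply Rinv_le_contravar; [apply pow_lt; auto|]. apply pow_incr; lra. }
  rewrite rsum_affine in H8.
  apply Rmult_le_reg_l with (16 * (2 ^ n * 2 ^ n) / PI ^ 2).
  - apply Rdiv_lt_0_compat; [nra|apply pow_lt; auto].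
  - replace (16 * (2 ^ n * 2 ^ n) / PI ^ 2 * (PI ^ 2 / 8)) with (2 * (2 ^ n * 2 ^ n))
      by (field; lra). lra.
Qed.

Lemma sum_odd_inv_sq (l : list nat) :
  NoDup l -> (forall d, In d l -> Nat.Odd d) -> rsum inv_sq l <= PI ^ 2 / 8.
Proof.
  intros Hl Ho.
  set (n := list_max l).
  eapply Rle_trans; [|apply (sum_odd_inv_sq_pow2 n)].
  rewrite <- (rsum_map inv_sq (fun k => 2 * k + 1)%nat).
  apply rsum_incl; auto using inv_sq_nonneg.
  intros d Hd. destruct (Ho d Hd) as [k ->]. apply in_map_iff. exists k. split; auto.
  apply in_seq. split; [lia|].
  assert (2 * k + 1 <= n)%nat.
  { pose proof (proj1 (list_max_le l n) (le_n _)) as H. rewrite Forall_forall in H. now apply H. }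
  pose proof (Nat.pow_gt_lin_r 2 n ltac:(lia)). lia.
Qed.

(** * Numerical bounds *)

Definition eta : R := 1 - 8 / PI ^ 2.

(** Fixed-point version of [rsum inv_sq] at scale 10^9, too small by at most 1 per term. Numerical
    bounds become integer comparisons decided by [vm_compute]. *)
Definition zfloor_sum (l : list nat) : Z :=
  fold_right (fun d s => (10 ^ 9 / (Z.of_nat d * Z.of_nat d) + s)%Z) 0%Z l.

Lemma inv_sq_floor (d : nat) : (0 < d)%nat ->
  IZR (10 ^ 9 / (Z.of_nat d * Z.of_nat d)) <= 1000000000 * inv_sq d
    <= IZR (10 ^ 9 / (Z.of_nat d * Z.of_nat d)) + 1.
Proof.
  intros Hd. unfold inv_sq. rewrite INR_IZR_INZ, <- mult_IZR.
  set (e := (Z.of_nat d * Z.of_nat d)%Z). assert (He : (0 < e)%Z) by (unfold e; nia).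
  assert (He' : 0 < IZR e) by now apply IZR_lt.
  pose proof (Z.mul_div_le (10 ^ 9) e He) as H1.
  pose proof (Z.mul_succ_div_gt (10 ^ 9) e He) as H2.
  apply IZR_le in H1. apply IZR_lt in H2.
  rewrite mult_IZR in H1, H2. rewrite succ_IZR in H2.
  change (10 ^ 9)%Z with 1000000000%Z in *.
  split; apply Rmult_le_reg_l with (IZR e); auto;
    replace (IZR e * (1000000000 * / IZR e)) with 1000000000 by (field; lra); lra.
Qed.

Lemma zfloor_sum_bounds (l : list nat) : (forall d, In d l -> (0 < d)%nat) ->
  IZR (zfloor_sum l) <= 1000000000 * rsum inv_sq l
    <= IZR (zfloor_sum l) + INR (length l).
Proof.
  induction l as [|d l IH]; intros H; [simpl; lra|].
  cbn [zfloor_sum fold_right rsum length]. fold (zfloor_sum l). fold (rsum inv_sq l).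
  rewrite plus_IZR, S_INR.
  pose proof (inv_sq_floor d (H d (or_introl eq_refl))).
  assert (forall d, In d l -> (0 < d)%nat) by (intros; apply H; now right).
  specialize (IH H1). lra.
Qed.

(** The bound on odd inverse squares also bounds pi from below: the first 100 terms exceed 1.23, so
    [8 / pi^2 <= 0.8133]. The value 0.1867 is just above [4 * 0.04666], the largest total density
    among the numerical cases. *)
Lemma eta_lower : 0.1867 <= eta.
Proof.
  pose proof (sum_odd_inv_sq (map (fun k => 2 * k + 1)%nat (seq 0 100))) as H.
  assert (H1 : 1.23 <= PI ^ 2 / 8).
  { eapply Rle_trans; [|apply H].
    - pose proof (zfloor_sum_bounds (map (fun k => 2 * k + 1)%nat (seq 0 100))) as Hb.
      assert (Hz : (1230000000 <= zfloor_sum (map (fun k => 2 * k + 1)%nat (seq 0 100)))%Z)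
        by (apply Z.leb_le; vm_compute; reflexivity).
      apply IZR_le in Hz.
      destruct Hb as [Hb _]; [|lra].
      intros d Hd. apply in_map_iff in Hd. destruct Hd as [k [<- _]]. lia.
    - apply NoDup_map_NoDup_ForallPairs; [intros a b _ _; lia|apply seq_NoDup].
    - intros d Hd. apply in_map_iff in Hd. destruct Hd as [k [<- _]]. now exists k. }
  unfold eta. assert (0 < PI ^ 2) by lra.
  assert (8 / PI ^ 2 <= 0.8133); [|lra].
  apply Rmult_le_reg_r with (PI ^ 2); auto.
  unfold Rdiv. rewrite Rmult_assoc, Rinv_l by lra. lra.
Qed.

(* Stands in for the primes [p >= 11]; the sum of [1 / d^2] is hardly larger. *)
Definition big_coprime (D : nat) : list nat :=
  filter (fun d => Nat.gcd d 210 =? 1)%nat (seq 11 D).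

(** Telescoping: [1 / a^2 <= 1 / (a - 1) - 1 / a]. *)
Lemma sum_tail (a k : nat) (f : nat -> bool) : (2 <= a)%nat ->
  rsum inv_sq (filter f (seq a k)) <= / INR (a - 1).
Proof.
  intros Ha.
  assert (H : rsum inv_sq (filter f (seq a k)) <= / INR (a - 1) - / INR (a + k - 1)).
  { revert a Ha. induction k as [|k IH]; intros a Ha.
    - rewrite Nat.add_0_r. simpl. lra.
    - simpl. specialize (IH (S a) ltac:(lia)).
      replace (S a - 1)%nat with a in IH by lia.
      replace (S a + k - 1)%nat with (a + S k - 1)%nat in IH by lia.
      assert (inv_sq a <= / INR (a - 1) - / INR a).
      { unfold inv_sq. rewrite minus_INR by lia. simpl (INR 1).
        assert (2 <= INR a) by (change 2 with (INR 2); apply le_INR; lia).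
        replace (/ (INR a - 1) - / INR a) with (/ ((INR a - 1) * INR a)) by (field; lra).
        apply Rinv_le_contravar; nra. }
      pose proof (inv_sq_nonneg a).
      destruct (f a); simpl; lra. }
  assert (0 < / INR (a + k - 1)) by (apply Rinv_0_lt_compat, lt_0_INR; lia). lra.
Qed.

Lemma sum_big_coprime (D : nat) : rsum inv_sq (big_coprime D) <= 0.0316.
Proof.
  (* Padding makes the range contain 11 to 3000. That block is evaluated in fixed point, at most
     0.03123, and the rest costs at most 1 / 3000. *)
  apply Rle_trans with (rsum inv_sq (big_coprime (2990 + D))).
  { apply rsum_incl; [apply inv_sq_nonneg| |].
    - apply NoDup_filter, seq_NoDup.
    - intros d Hd. apply filter_In in Hd. apply filter_In. split; [|tauto].
      destruct Hd as [Hd _]. apply in_seq in Hd. apply in_seq. lia. }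
  unfold big_coprime. rewrite seq_app, filter_app, rsum_app.
  pose proof (sum_tail (11 + 2990) D (fun d => Nat.gcd d 210 =? 1)%nat ltac:(lia)) as Ht.
  replace (INR (11 + 2990 - 1)) with 3000 in Ht
    by (rewrite INR_IZR_INZ; apply f_equal; vm_compute; reflexivity).
  set (l := filter (fun d => Nat.gcd d 210 =? 1)%nat (seq 11 2990)) in *.
  destruct (zfloor_sum_bounds l) as [_ Hb].
  { intros d Hd. apply filter_In in Hd. destruct Hd as [Hd _]. apply in_seq in Hd. lia. }
  assert (Hz : (zfloor_sum l + Z.of_nat (length l) <= 31230000)%Z)
    by (apply Z.leb_le; vm_compute; reflexivity).
  apply IZR_le in Hz. rewrite plus_IZR, <- INR_IZR_INZ in Hz. lra.
Qed.

(** * Primes *)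

Definition nprime (p : nat) : Prop := prime (Z.of_nat p).

Lemma exists_prime_divisor (n : nat) : (2 <= n)%nat ->
  exists p, nprime p /\ (Z.of_nat p | Z.of_nat n)%Z.
Proof.
  induction n as [n IH] using lt_wf_ind. intros Hn.
  destruct (prime_dec (Z.of_nat n)) as [Hp|Hp].
  - exists n. split; auto. apply Z.divide_refl.
  - apply not_prime_divide in Hp; [|lia]. destruct Hp as [d [Hd1 Hd2]].
    destruct (IH (Z.to_nat d)) as [p [Hp Hpd]]; [lia|lia|].
    exists p. split; auto. rewrite Z2Nat.id in Hpd by lia.
    now apply Z.divide_trans with d.
Qed.

Lemma nat_divide_Z (a b : nat) : Nat.divide a b <-> (Z.of_nat a | Z.of_nat b)%Z.
Proof.
  split.
  - intros [k ->]. exists (Z.of_nat k). lia.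
  - intros [k Hk]. destruct a as [|a].
    + exists 0%nat. lia.
    + exists (Z.to_nat k). nia.
Qed.

Lemma not_squarefree_prime (m : nat) : ~ squarefree m -> (m mod 4 <> 0)%nat ->
  exists p, nprime p /\ p <> 2%nat /\ (Z.of_nat (p * p) | Z.of_nat m)%Z.
Proof.
  intros Hm H4.
  apply not_all_ex_not in Hm. destruct Hm as [d Hd].
  apply imply_to_and in Hd. destruct Hd as [Hd Hd1].
  assert (d <> 0)%nat.
  { intros ->. destruct Hd as [k ->]. apply H4. now rewrite Nat.mul_0_r. }
  destruct (exists_prime_divisor d) as [p [Hp [k Hk]]]; [lia|].
  assert (Hpm : (Z.of_nat (p * p) | Z.of_nat m)%Z).
  { apply nat_divide_Z in Hd. apply Z.divide_trans with (Z.of_nat (d * d)); auto.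
    exists (k * k)%Z. lia. }
  exists p. split; [exact Hp|split; [|exact Hpm]].
  intros ->. apply H4. apply nat_divide_Z in Hpm. now apply Nat.Lcm0.mod_divide.
Qed.

Lemma nprime_pos (p : nat) : nprime p -> (2 <= p)%nat.
Proof. intros [H _]. lia. Qed.

Lemma nprime_not_composite (p a : nat) : nprime p -> (1 < a < p)%nat ->
  ~ (Z.of_nat a | Z.of_nat p)%Z.
Proof. intros Hp Ha Hd. apply prime_divisors in Hd; [lia|exact Hp]. Qed.

Lemma nprime_rel_prime (p : nat) (z : Z) :
  nprime p -> ~ (Z.of_nat p | z)%Z -> rel_prime (Z.of_nat p) z.
Proof. intros; now apply prime_rel_prime. Qed.

Lemma nprimes_rel_prime (p q : nat) :
  nprime p -> nprime q -> p <> q -> rel_prime (Z.of_nat p) (Z.of_nat q).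
Proof.
  intros Hp Hq Hne. apply prime_rel_prime; auto. intros H.
  apply prime_div_prime in H; auto; lia.
Qed.

Lemma rel_prime_sqr (a b : Z) : rel_prime a b -> rel_prime (a * a) (b * b).
Proof.
  intros H.
  assert (H' : rel_prime a (b * b)) by now apply rel_prime_mult.
  apply rel_prime_sym, rel_prime_mult; now apply rel_prime_sym.
Qed.

Lemma nprime_2 : nprime 2. Proof. apply prime_2. Qed.
Lemma nprime_3 : nprime 3. Proof. apply prime_3. Qed.

Lemma nprime_of_check (p : nat) : (2 <= p)%nat ->
  forallb (fun a => negb (p mod a =? 0)%nat) (seq 2 (p - 2)) = true -> nprime p.
Proof.
  intros Hp H. destruct (prime_dec (Z.of_nat p)) as [|Hn]; auto. exfalso.
  apply not_prime_divide in Hn; [|lia]. destruct Hn as [d [Hd1 Hd2]].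
  rewrite forallb_forall in H.
  assert (Hin : In (Z.to_nat d) (seq 2 (p - 2))) by (apply in_seq; lia).
  apply H, Bool.negb_true_iff, Nat.eqb_neq in Hin. apply Hin.
  apply Nat.Lcm0.mod_divide, nat_divide_Z. now rewrite Z2Nat.id by lia.
Qed.

Lemma nprime_5 : nprime 5. Proof. apply nprime_of_check; [lia|reflexivity]. Qed.
Lemma nprime_7 : nprime 7. Proof. apply nprime_of_check; [lia|reflexivity]. Qed.

Lemma gcd_rel_prime (a b : nat) :
  Nat.gcd a b = 1%nat <-> rel_prime (Z.of_nat a) (Z.of_nat b).
Proof.
  split.
  - intros H. constructor; try apply Z.divide_1_l. intros x Ha Hb.
    apply Z.divide_abs_l in Ha, Hb.
    replace (Z.abs x) with (Z.of_nat (Z.to_nat (Z.abs x))) in Ha, Hb by lia.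
    apply nat_divide_Z in Ha, Hb.
    pose proof (Nat.gcd_greatest _ _ _ Ha Hb) as Hx. rewrite H in Hx.
    apply nat_divide_Z in Hx. apply Z.divide_abs_l.
    now replace (Z.abs x) with (Z.of_nat (Z.to_nat (Z.abs x))) by lia.
  - intros [_ _ H].
    pose proof (Nat.gcd_divide_l a b) as Ha. pose proof (Nat.gcd_divide_r a b) as Hb.
    apply nat_divide_Z in Ha, Hb. specialize (H _ Ha Hb).
    change 1%Z with (Z.of_nat 1) in H. apply nat_divide_Z in H. now apply Nat.divide_1_r in H.
Qed.

Lemma odd_prime_cases (p : nat) : nprime p -> p <> 2%nat ->
  p = 3%nat \/ p = 5%nat \/ p = 7%nat \/ ((11 <= p)%nat /\ Nat.gcd p 210 = 1%nat).
Proof.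
  intros Hp H2.
  destruct (Nat.eq_dec p 3); auto. destruct (Nat.eq_dec p 5); auto.
  destruct (Nat.eq_dec p 7); auto. do 3 right. split.
  - pose proof (nprime_pos p Hp).
    pose proof (nprime_not_composite p 2 Hp) as H2'.
    pose proof (nprime_not_composite p 3 Hp) as H3'.
    destruct (le_lt_dec 11 p) as [|Hlt]; auto. exfalso.
    assert (Hc : (p = 4 \/ p = 6 \/ p = 8 \/ p = 9 \/ p = 10)%nat) by lia.
    destruct Hc as [->|[->|[->|[->| ->]]]];
      try (apply H2'; [lia|apply nat_divide_Z; now apply Nat.Lcm0.mod_divide]).
    apply H3'; [lia|apply nat_divide_Z; now apply Nat.Lcm0.mod_divide].
  - assert (Hr : rel_prime (Z.of_nat p) 210).
    { change 210%Z with (Z.of_nat 2 * (Z.of_nat 3 * (Z.of_nat 5 * Z.of_nat 7)))%Z.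
      repeat apply rel_prime_mult; apply nprimes_rel_prime;
        auto using nprime_2, nprime_3, nprime_5, nprime_7. }
    now apply (gcd_rel_prime p 210).
Qed.

(* Euclid: with K the product of the primes 5 <= p < q, every prime factor of
   K + 6 is at least q, so K >= q - 6. *)
Lemma primorial (q : nat) : exists K : nat, (1 <= K)%nat /\
  (forall p, nprime p -> ((Z.of_nat p | Z.of_nat K)%Z <-> (5 <= p < q)%nat)) /\
  (forall D, (forall p, nprime p -> (5 <= p < q)%nat -> (Z.of_nat (p * p) | D)%Z) ->
     (Z.of_nat (K * K) | D)%Z).
Proof.
  induction q as [|q IH].
  - exists 1%nat. split; [lia|]. split.
    + intros p Hp. split; [|lia]. intros H. pose proof (nprime_pos p Hp).
      apply Z.divide_pos_le in H; lia.
    + intros D _. apply Z.divide_1_l.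
  - destruct IH as [K [HK [Hdiv HD]]].
    destruct (classic (nprime q /\ (5 <= q)%nat)) as [[Hq Hq5]|Hq].
    + exists (K * q)%nat. split; [nia|]. split.
      * intros p Hp. rewrite Nat2Z.inj_mul. split.
        -- intros H. apply prime_mult in H; auto. destruct H as [H|H].
           ++ apply Hdiv in H; auto; lia.
           ++ apply prime_div_prime in H; auto; lia.
        -- intros H. destruct (Nat.eq_dec p q) as [->|].
           ++ now exists (Z.of_nat K).
           ++ apply Z.divide_mul_l, Hdiv; auto. lia.
      * intros D H.
        replace (Z.of_nat (K * q * (K * q))) with (Z.of_nat (K * K) * Z.of_nat (q * q))%Z by lia.
        apply rel_prime_mul_divide.
        -- rewrite !Nat2Z.inj_mul. apply rel_prime_sqr, rel_prime_sym, nprime_rel_prime; auto.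
           rewrite Hdiv by auto. lia.
        -- apply HD. intros p Hp Hpq. apply H; auto; lia.
        -- apply H; auto; lia.
    + exists K. split; auto. split.
      * intros p Hp. rewrite Hdiv by auto. split; [lia|]. intros H.
        destruct (Nat.eq_dec p q) as [->|]; [tauto|lia].
      * intros D H. apply HD. intros p Hp Hpq. apply H; auto; lia.
Qed.

(** [D] is a multiple of 4 and of [p^2] for each odd prime [p < q]: 900 suffices for [q = 7], 44100
    up to [q = 40], and [36 K^2] with [K >= q - 6] beyond. The factor 16 gives a class modulo 4 the
    relative density [1 / (4 q^2)], so that three classes together stay below the loss
    [0.7967 / q^2]. *)
Lemma square_gap (q : nat) (D : Z) : (7 <= q)%nat -> (0 < D)%Z -> (4 | D)%Z ->
  (forall p, nprime p -> p <> 2%nat -> (p < q)%nat -> (Z.of_nat (p * p) | D)%Z) ->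
  (16 * Z.of_nat (q * q) <= D)%Z.
Proof.
  intros Hq HD H4 Hp.
  assert (H36 : (36 | D)%Z).
  { change 36%Z with (4 * 9)%Z. apply rel_prime_mul_divide; auto.
    - now apply Zgcd_1_rel_prime.
    - apply (Hp 3%nat); auto using nprime_3; lia. }
  assert (H900 : (900 | D)%Z).
  { change 900%Z with (36 * 25)%Z. apply rel_prime_mul_divide; auto.
    - now apply Zgcd_1_rel_prime.
    - apply (Hp 5%nat); auto using nprime_5; lia. }
  destruct (Nat.eq_dec q 7) as [->|Hq7].
  { apply Z.divide_pos_le in H900; lia. }
  destruct (le_lt_dec q 40) as [Hq40|Hq40].
  { assert (H44100 : (44100 | D)%Z).
    { change 44100%Z with (900 * 49)%Z. apply rel_prime_mul_divide; auto.
      - now apply Zgcd_1_rel_prime.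
      - apply (Hp 7%nat); auto using nprime_7; lia. }
    apply Z.divide_pos_le in H44100; nia. }
  destruct (primorial q) as [K [HK [Hdiv HKD]]].
  assert (HK6 : (q <= K + 6)%nat).
  { destruct (exists_prime_divisor (K + 6)) as [p [Hpp HpK]]; [lia|].
    rewrite Nat2Z.inj_add in HpK.
    destruct (le_lt_dec q p) as [Hle|Hlt].
    - rewrite <- Nat2Z.inj_add in HpK. apply Z.divide_pos_le in HpK; lia.
    - exfalso.
      assert (H6 : (Z.of_nat p | 6)%Z -> (p = 2 \/ p = 3)%nat).
      { intros H. change 6%Z with (Z.of_nat 2 * Z.of_nat 3)%Z in H.
        apply prime_mult in H; auto.
        destruct H as [H|H]; apply prime_div_prime in H; auto using prime_2, prime_3;
          unfold nprime in *; lia. }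
      assert (Hc : (Z.of_nat p | Z.of_nat K)%Z).
      { destruct (le_lt_dec 5 p); [apply Hdiv; auto|].
        apply (Z.divide_add_cancel_r _ (Z.of_nat 6)); [|now rewrite Z.add_comm].
        pose proof (nprime_pos p Hpp).
        assert (Hp23 : (p = 2 \/ p = 3 \/ p = 4)%nat) by lia.
        destruct Hp23 as [->|[->| ->]].
        - now exists 3%Z.
        - now exists 2%Z.
        - exfalso. apply (nprime_not_composite 4 2); [exact Hpp|lia|now exists 2%Z]. }
      assert (Hp6 : (Z.of_nat p | Z.of_nat 6)%Z).
      { now apply (Z.divide_add_cancel_r _ (Z.of_nat K)). }
      apply H6 in Hp6. apply Hdiv in Hc; auto. lia. }
  assert (Hfin : (36 * Z.of_nat (K * K) | D)%Z).
  { apply rel_prime_mul_divide; auto.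
    - change 36%Z with ((Z.of_nat 2 * Z.of_nat 3) * (Z.of_nat 2 * Z.of_nat 3))%Z.
      rewrite Nat2Z.inj_mul. apply rel_prime_sqr, rel_prime_sym.
      apply rel_prime_mult; apply rel_prime_sym, nprime_rel_prime;
        auto using nprime_2, nprime_3; rewrite Hdiv by auto using nprime_2, nprime_3; lia.
    - apply HKD. intros p Hpp Hpq. apply Hp; auto; lia. }
  apply Z.divide_pos_le in Hfin; nia.
Qed.

(** * Shifts with an odd square factor *)

(** A sum of two elements is at most [2 * x], so a number whose square divides it lies below this
    bound. *)
Definition root_bound (x : R) : nat := Z.to_nat (up (sqrt (2 * x))).

Lemma root_bound_spec (x : R) (p : nat) : 0 <= x ->
  INR p * INR p <= 2 * x -> (p < root_bound x)%nat.
Proof.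
  intros Hx Hp.
  assert (Hs : INR p <= sqrt (2 * x)).
  { rewrite <- (sqrt_square (INR p)) by apply pos_INR. now apply sqrt_le_1_alt. }
  destruct (archimed (sqrt (2 * x))) as [H _].
  unfold root_bound. rewrite INR_IZR_INZ in Hs.
  assert (IZR (Z.of_nat p) < IZR (up (sqrt (2 * x)))) by lra.
  apply lt_IZR in H0. lia.
Qed.

Lemma root_bound_negligible (C delta : R) : 0 < C -> 0 < delta ->
  exists x0, 1 <= x0 /\ forall x, x0 < x -> C * (INR (root_bound x) + 1) <= delta * x.
Proof.
  (* For [sqrt x >= 1], [root_bound x + 1 <= sqrt (2 x) + 2 <= 4 sqrt x], and past this threshold
     [4 C <= delta sqrt x]. *)
  intros HC Hd. exists (1 + (4 * C / delta) ^ 2).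
  assert (H4 : 0 < 4 * C / delta) by (apply Rdiv_lt_0_compat; lra).
  split; [pose proof (pow2_ge_0 (4 * C / delta)); lra|].
  intros x Hx. pose proof (pow2_ge_0 (4 * C / delta)).
  assert (Hr : INR (root_bound x) <= sqrt (2 * x) + 1).
  { pose proof (sqrt_pos (2 * x)). destruct (archimed (sqrt (2 * x))) as [H1 H2].
    unfold root_bound. rewrite INR_IZR_INZ, Z2Nat.id; [lra|].
    apply le_IZR. lra. }
  assert (Hs1 : 1 <= sqrt x) by (rewrite <- sqrt_1; apply sqrt_le_1_alt; lra).
  assert (Hs4 : 4 * C / delta <= sqrt x).
  { rewrite <- (sqrt_square (4 * C / delta)) by lra. apply sqrt_le_1_alt. lra. }
  assert (Hs2 : sqrt (2 * x) <= 2 * sqrt x).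
  { replace 2 with (sqrt (2 * 2)) at 2 by (apply sqrt_square; lra).
    rewrite <- sqrt_mult_alt by lra. apply sqrt_le_1_alt. lra. }
  assert (Hxx : x = sqrt x * sqrt x) by (symmetry; apply sqrt_sqrt; lra).
  assert (4 * C <= delta * sqrt x).
  { apply Rmult_le_compat_l with (r := delta) in Hs4; [|lra].
    replace (delta * (4 * C / delta)) with (4 * C) in Hs4 by (field; lra). lra. }
  rewrite Hxx at 2. nra.
Qed.

Lemma odd_square_decomp (m : nat) : (1 <= m)%nat ->
  exists d s, (m = d * d * s)%nat /\ Nat.Odd d /\
    forall e, Nat.Odd e -> (3 <= e)%nat -> ~ Nat.divide (e * e) s.
Proof.
  induction m as [m IH] using lt_wf_ind. intros Hm.
  destruct (classic (exists e, Nat.Odd e /\ (3 <= e)%nat /\ Nat.divide (e * e) m))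
    as [[e [He [He3 [k Hk]]]]|Hn].
  - assert (k <> 0)%nat by (intros ->; lia).
    assert (9 <= e * e)%nat by nia.
    destruct (IH k) as [d [s [Hds [Hd Hs]]]]; [nia|nia|].
    exists (e * d)%nat, s. split; [nia|]. split; auto.
    now apply Nat.Odd_mul.
  - exists 1%nat, m. split; [lia|]. split; [now exists 0%nat|].
    intros e He He3 Hdiv. apply Hn; eauto.
Qed.

(** Truncation at [P] makes divisibility by an odd square periodic, so that its density is a count
    of residues; the divisors beyond [P] contribute at most about [1 / P]. *)
Definition odd_covered (P m : nat) : Prop :=
  exists d, (3 <= d <= P)%nat /\ Nat.Odd d /\ (Z.of_nat (d * d) | Z.of_nat m)%Z.

(** A common multiple of all [d^2] with [1 <= d <= P]; the factor 4 lets a residue determine its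
    class modulo 4. *)
Definition cover_period (P : nat) : nat := (4 * (fact P * fact P))%nat.

Lemma divide_fact (d P : nat) : (1 <= d <= P)%nat -> Nat.divide d (fact P).
Proof.
  induction P as [|P IH]; intros H; [lia|].
  destruct (Nat.eq_dec d (S P)) as [->|].
  - exists (fact P). simpl. lia.
  - simpl. apply Nat.divide_add_r.
    + apply IH; lia.
    + apply Nat.divide_mul_r, IH; lia.
Qed.

Lemma odd_covered_cong (P m m' : nat) :
  (Z.of_nat (cover_period P) | Z.of_nat m - Z.of_nat m')%Z ->
  odd_covered P m -> odd_covered P m'.
Proof.
  intros Hc [d [Hd [Ho Hdiv]]]. exists d. repeat split; auto; try tauto.
  assert (Hd' : (Z.of_nat (d * d) | Z.of_nat (cover_period P))%Z).
  { apply nat_divide_Z. unfold cover_period. apply Nat.divide_mul_r.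
    destruct (divide_fact d P) as [k ->]; [lia|]. exists (k * k)%nat. nia. }
  replace (Z.of_nat m') with (Z.of_nat m - (Z.of_nat m - Z.of_nat m'))%Z by lia.
  apply Z.divide_sub_r; auto. now apply Z.divide_trans with (Z.of_nat (cover_period P)).
Qed.

Definition class_list (c N : nat) : list nat := map (fun k => 4 * k + c)%nat (seq 0 N).

Lemma class_list_NoDup (c N : nat) : NoDup (class_list c N).
Proof. apply NoDup_map_NoDup_ForallPairs; [intros a b _ _; lia|apply seq_NoDup]. Qed.

Lemma in_class_list (c N m : nat) : (c < 4)%nat ->
  (In m (class_list c N) <-> (m mod 4 = c /\ m < 4 * N)%nat).
Proof.
  intros Hc. unfold class_list. rewrite in_map_iff. split.
  - intros [k [<- Hk]]. apply in_seq in Hk. split; [|lia].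
    replace (4 * k + c)%nat with (c + k * 4)%nat by lia.
    rewrite Nat.Div0.mod_add. now apply Nat.mod_small.
  - intros [Hm Hlt]. exists (m / 4)%nat. pose proof (Nat.div_mod_eq m 4).
    split; [lia|]. apply in_seq. lia.
Qed.

Definition uncovered_residues (P c : nat) : list nat :=
  filter (fun r => negb (classicb (odd_covered P r))) (class_list c (fact P * fact P)).

Lemma cong_mod (M n : nat) :
  (Z.of_nat M | Z.of_nat n - Z.of_nat (n mod M)%nat)%Z.
Proof. rewrite (Nat.div_mod_eq n M) at 1. exists (Z.of_nat (n / M)). lia. Qed.

Lemma mod_mul_mod (n F : nat) : (0 < F)%nat -> ((n mod (4 * F)) mod 4 = n mod 4)%nat.
Proof.
  intros HF. rewrite (Nat.div_mod_eq n (4 * F)) at 2.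
  replace (4 * F * (n / (4 * F)) + n mod (4 * F))%nat
    with (n mod (4 * F) + (F * (n / (4 * F))) * 4)%nat by lia.
  now rewrite Nat.Div0.mod_add.
Qed.

(* Every [m] is [d^2 s] with [d] odd and [s] uncovered, and [s = m] modulo 4;
   counting the [m < Y] in the class [c] by [d] gives [1 <= density * sum 1/d^2]. *)
Lemma uncovered_count (P c : nat) : (1 <= c <= 3)%nat ->
  INR (fact P) * INR (fact P) <= INR (length (uncovered_residues P c)) * (PI ^ 2 / 8).
Proof.
  intros Hc.
  set (F := (fact P * fact P)%nat). set (M := cover_period P).
  set (g := length (uncovered_residues P c)).
  assert (HF : (1 <= F)%nat) by (pose proof (lt_O_fact P); unfold F; nia).
  assert (HM : M = (4 * F)%nat) by reflexivity.
  assert (HF' : 1 <= INR F) by (change 1 with (INR 1); now apply le_INR).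
  assert (HM' : INR M = 4 * INR F) by (rewrite HM, mult_INR; simpl; lra).
  (* The range counted has length [(t M)^2], so only [d < t M] occur. Rounding costs [g] for each
     such [d], which is linear in [t] against a main term quadratic in [t]; a large [t] removes
     it. *)
  assert (Hkey : forall t : nat, (1 <= t)%nat ->
     INR F * INR t <= INR g * (PI ^ 2 / 8) * INR t + INR g).
  { intros t Ht.
    set (T := (t * t * M)%nat). set (L := filter Nat.odd (seq 1 (t * M))).
    assert (HT : INR T = INR t * INR t * INR M) by (unfold T; now rewrite !mult_INR).
    assert (Ht' : 1 <= INR t) by (change 1 with (INR 1); now apply le_INR).
    assert (Hcard : card_le (fun m => In m (class_list c (F * T)))
      (rsum (fun d => rsum (fun r : nat => INR (T * M) / INR (d * d * M) + 1)
         (uncovered_residues P c)) L)).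
    { eapply card_le_mono with (P := fun m => exists d, In d L /\ exists r,
         In r (uncovered_residues P c) /\ In m (class_list c (F * T)) /\
         exists s, m = (d * d * s)%nat /\ (Z.of_nat M | Z.of_nat s - Z.of_nat r)%Z);
        [apply card_le_Union | | apply Rle_refl].
      - intros d Hd. apply filter_In in Hd. destruct Hd as [Hd _]. apply in_seq in Hd.
        apply card_le_Union. intros r Hr. apply card_le_cong.
        + repeat apply Nat.mul_pos_pos; lia.
        + apply pos_INR.
        + intros m [Hm _]. apply in_class_list in Hm; [|lia]. apply le_INR. nia.
        + intros m m' [_ [s [-> Hs]]] [_ [s' [-> Hs']]].
          rewrite !Nat2Z.inj_mul.
          replace (Z.of_nat d * Z.of_nat d * Z.of_nat s - Z.of_nat d * Z.of_nat d * Z.of_nat s')%Z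
            with (Z.of_nat d * Z.of_nat d *
              ((Z.of_nat s - Z.of_nat r) - (Z.of_nat s' - Z.of_nat r)))%Z by lia.
          apply Z.mul_divide_mono_l. now apply Z.divide_sub_r.
      - intros m Hm. pose proof Hm as Hm0. apply in_class_list in Hm; [|lia].
        destruct Hm as [Hmc HmT].
        assert (m <> 0)%nat by (intros ->; rewrite Nat.Div0.mod_0_l in Hmc; lia).
        destruct (odd_square_decomp m) as [d [s [Hds [Hd Hs]]]]; [lia|].
        assert (Hs0 : (1 <= s)%nat) by nia.
        exists d. split.
        + apply filter_In. split; [|now apply Nat.odd_spec].
          apply in_seq. destruct Hd as [k ->].
          assert ((2 * k + 1) * (2 * k + 1) < (t * M) * (t * M))%nat.
          { apply Nat.le_lt_trans with m; [nia|].
            apply Nat.lt_le_trans with (4 * (F * T))%nat; auto. unfold T. rewrite HM. nia. }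
          split; [lia|]. nia.
        + exists (s mod M)%nat. split; [|split; auto; exists s; split; auto using cong_mod].
          assert (Hs4 : (s mod 4 = c)%nat).
          { rewrite <- Hmc, Hds. destruct Hd as [k ->].
            replace ((2 * k + 1) * (2 * k + 1) * s)%nat with (s + (k * k + k) * s * 4)%nat by lia.
            now rewrite Nat.Div0.mod_add. }
          apply filter_In. split.
          * apply in_class_list; [lia|]. fold F. split.
            -- rewrite HM, mod_mul_mod; auto.
            -- rewrite <- HM. apply Nat.mod_upper_bound. lia.
          * apply Bool.negb_true_iff, classicb_false. intros Hcov.
            apply (odd_covered_cong P _ s) in Hcov.
            -- destruct Hcov as [e [He [Heo Hediv]]]. apply (Hs e); auto; [lia|].
               now apply nat_divide_Z.
            -- fold M. pose proof (cong_mod M s) as H'.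
               apply Z.divide_opp_r in H'. now replace (Z.of_nat (s mod M) - Z.of_nat s)%Z
                 with (- (Z.of_nat s - Z.of_nat (s mod M)))%Z by lia. }
    specialize (Hcard (class_list c (F * T)) (class_list_NoDup _ _) (fun _ H => H)).
    unfold class_list in Hcard at 1. rewrite length_map, length_seq in Hcard.
    assert (Hsum : rsum (fun d => rsum (fun r : nat => INR (T * M) / INR (d * d * M) + 1)
         (uncovered_residues P c)) L <= rsum (fun d => INR g * INR T * inv_sq d + INR g) L).
    { apply rsum_le. intros d Hd. rewrite rsum_const. fold g.
      apply filter_In in Hd. destruct Hd as [Hd _]. apply in_seq in Hd.
      assert (0 < INR d) by (apply lt_0_INR; lia).
      rewrite !mult_INR. unfold inv_sq. right. field. lra. }
    rewrite rsum_affine in Hsum.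
    assert (HLs : rsum inv_sq L <= PI ^ 2 / 8).
    { apply sum_odd_inv_sq; [apply NoDup_filter, seq_NoDup|].
      intros d Hd. apply filter_In in Hd. now apply Nat.odd_spec. }
    assert (HLl : INR (length L) <= INR t * INR M).
    { rewrite <- mult_INR. apply le_INR. unfold L.
      rewrite <- (length_seq (t * M) 1) at 2. apply filter_length_le. }
    assert (Hg : 0 <= INR g) by apply pos_INR.
    rewrite mult_INR in Hcard.
    assert (Hb : INR F * INR T <= INR g * INR T * (PI ^ 2 / 8) + INR t * INR M * INR g).
    { assert (INR g * INR T * rsum inv_sq L <= INR g * INR T * (PI ^ 2 / 8)).
      { apply Rmult_le_compat_l; auto. apply Rmult_le_pos; auto. apply pos_INR. }
      assert (INR (length L) * INR g <= INR t * INR M * INR g)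
        by (apply Rmult_le_compat_r; auto).
      lra. }
    rewrite HT in Hb.
    apply Rmult_le_reg_r with (INR t * INR M); [nra|]. nra. }
  rewrite <- mult_INR. fold F.
  apply Rnot_lt_le. intros Hlt.
  set (D := INR F - INR g * (PI ^ 2 / 8)) in *.
  assert (HD : 0 < D) by (unfold D; lra).
  destruct (INR_unbounded (INR g / D)) as [t Ht].
  assert (Hg : INR g < D * INR (S t)).
  { rewrite S_INR. apply Rmult_lt_compat_l with (r := D) in Ht; auto.
    replace (D * (INR g / D)) with (INR g) in Ht by (field; lra). lra. }
  specialize (Hkey (S t) ltac:(lia)). unfold D in Hg. nra.
Qed.

(** The set to which one neighbour [b] confines the class [c]. It does not depend on [A], so
    elements lost to a second neighbour can be counted inside it. *)
Definition odd_square_shift (x : R) (b c n : nat) : Prop :=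
  INR n <= x /\ (n mod 4 = c)%nat /\
  exists d, (3 <= d)%nat /\ Nat.Odd d /\ (Z.of_nat (d * d) | Z.of_nat n + Z.of_nat b)%Z.

Lemma mod4_cong (n n' c : nat) : (n mod 4 = c)%nat -> (n' mod 4 = c)%nat ->
  (Z.of_nat 4 | Z.of_nat n - Z.of_nat n')%Z.
Proof.
  intros H H'. pose proof (Nat.div_mod_eq n 4). pose proof (Nat.div_mod_eq n' 4).
  exists (Z.of_nat (n / 4) - Z.of_nat (n' / 4))%Z. lia.
Qed.

Lemma odd_rel_prime_4 (d : nat) : Nat.Odd d -> rel_prime (Z.of_nat 4) (Z.of_nat d).
Proof.
  intros [k ->]. apply rel_prime_sym. change (Z.of_nat 4) with (2 * 2)%Z.
  assert (rel_prime (Z.of_nat (2 * k + 1)) 2).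
  { apply rel_prime_sym, prime_rel_prime; [apply prime_2|]. intros [z Hz]. lia. }
  now apply rel_prime_mult.
Qed.

(** The threshold depends on [delta] alone, which is essential since [b] may be as large as [x].
    Translation by [b] carries the class [c] to a nonzero class modulo 4, where at most a fraction
    [eta] of the residues is covered; divisors beyond [P > 1 / delta] are sieved one by one. *)
Lemma odd_square_shift_density (delta : R) : 0 < delta ->
  exists x0, forall x, x0 < x -> forall b c, INR b <= x -> ((b + c) mod 4 <> 0)%nat ->
    card_le (odd_square_shift x b c) ((eta / 4 + delta) * x).
Proof.
  intros Hdelta.
  destruct (INR_unbounded (/ delta)) as [P0 HP0].
  set (P := S P0).
  set (F := (fact P * fact P)%nat). set (M := cover_period P).
  assert (HF : (1 <= F)%nat) by (pose proof (lt_O_fact P); unfold F; nia).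
  assert (HM : M = (4 * F)%nat) by reflexivity.
  assert (HF' : 1 <= INR F) by (change 1 with (INR 1); now apply le_INR).
  assert (HM' : INR M = 4 * INR F) by (rewrite HM, mult_INR; simpl; lra).
  destruct (root_bound_negligible (INR F + 1) (delta / 2)) as [x0 [Hx0 Herr]]; [lra|lra|].
  exists x0. intros x Hx b c Hb Hbc.
  specialize (Herr x Hx).
  set (D := root_bound x) in *.
  destruct (classic (c < 4)%nat) as [Hc4|Hc4].
  2:{ eapply card_le_mono; [apply (card_le_empty (odd_square_shift x b c))|auto|].
      - intros n [_ [Hn _]]. pose proof (Nat.mod_upper_bound n 4). lia.
      - pose proof eta_lower. apply Rmult_le_pos; lra. }
  set (c' := ((b + c) mod 4)%nat) in *.
  assert (Hc' : (1 <= c' <= 3)%nat)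
    by (pose proof (Nat.mod_upper_bound (b + c) 4 ltac:(lia)); unfold c' in *; lia).
  assert (Hmod : forall n, (n mod 4 = c)%nat -> ((n + b) mod 4 = c')%nat).
  { intros n Hn. unfold c'. rewrite <- Nat.Div0.add_mod_idemp_l, Hn. f_equal. lia. }
  set (cov := filter (fun r => classicb (odd_covered P r)) (class_list c' F)).
  assert (H1 : card_le (fun n => exists r, In r cov /\ (INR n <= x /\
       (Z.of_nat M | Z.of_nat (n + b) - Z.of_nat r)%Z))
     (rsum (fun _ : nat => x / INR M + 1) cov)).
  { apply card_le_Union. intros r _. apply card_le_cong; [lia|lra|now intros n [H _]|].
    intros n n' [_ Hn] [_ Hn'].
    replace (Z.of_nat n - Z.of_nat n')%Z with
      ((Z.of_nat (n + b) - Z.of_nat r) - (Z.of_nat (n' + b) - Z.of_nat r))%Z by lia.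
    now apply Z.divide_sub_r. }
  set (L := filter Nat.odd (seq (S P) D)).
  assert (H2 : card_le (fun n => (INR n <= x /\ (n mod 4 = c)%nat) /\
      exists d, In d L /\ (Z.of_nat (d * d) | Z.of_nat n + Z.of_nat b)%Z)
     (x / INR 4 * rsum inv_sq L + INR (length L) * INR 1)).
  { apply card_le_sieve with (a := fun _ => b); try lia; try lra.
    - now intros n [[H _] _].
    - intros n n' [[_ H] _] [[_ H'] _]. now apply mod4_cong with c.
    - apply rel_prime_sym, rel_prime_1.
    - intros d Hd. apply filter_In in Hd. destruct Hd as [Hd Ho].
      apply in_seq in Hd. apply Nat.odd_spec in Ho.
      split; [lia|]. split; [now apply odd_rel_prime_4|apply rel_prime_1].
    - now intros n [_ H]. }
  eapply card_le_mono; [exact (card_le_union _ _ _ _ H1 H2)| |].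
  - intros n [Hn [Hnc [d [Hd3 [Ho Hd]]]]].
    destruct (le_lt_dec d P) as [HdP|HdP].
    + left. exists ((n + b) mod M)%nat. split; [|split; auto using cong_mod].
      apply filter_In. split.
      * apply in_class_list; [lia|]. split.
        -- rewrite HM, mod_mul_mod; auto.
        -- rewrite <- HM. apply Nat.mod_upper_bound. lia.
      * apply classicb_true. apply (odd_covered_cong P (n + b)); [apply cong_mod|].
        exists d. repeat split; auto. now rewrite Nat2Z.inj_add.
    + right. split; auto. exists d. split; auto.
      apply filter_In. split; [|now apply Nat.odd_spec]. apply in_seq.
      assert (Hpos : (n + b <> 0)%nat).
      { intros H0. specialize (Hmod n Hnc). rewrite H0 in Hmod.
        rewrite Nat.Div0.mod_0_l in Hmod. lia. }
      rewrite <- Nat2Z.inj_add in Hd. apply Z.divide_pos_le in Hd; [|lia].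
      assert (Hd' : (d * d <= n + b)%nat) by lia.
      apply le_INR in Hd'. rewrite mult_INR, plus_INR in Hd'.
      pose proof (root_bound_spec x d ltac:(lra) ltac:(lra)). fold D in H. lia.
  - rewrite rsum_const.
    assert (Hlen : (length cov + length (uncovered_residues P c') = F)%nat).
    { unfold cov, uncovered_residues. fold F.
      rewrite filter_length_compl. unfold class_list. now rewrite length_map, length_seq. }
    pose proof (uncovered_count P c' Hc') as Hg. rewrite <- mult_INR in Hg. fold F in Hg.
    apply f_equal with (f := INR) in Hlen. rewrite plus_INR in Hlen.
    set (g := INR (length (uncovered_residues P c'))) in *.
    assert (HL : rsum inv_sq L <= delta).
    { eapply Rle_trans; [apply sum_tail; unfold P; lia|].
      replace (S P - 1)%nat with P by lia. unfold P.
      rewrite <- (Rinv_inv delta). apply Rinv_le_contravar.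
      - now apply Rinv_0_lt_compat.
      - rewrite S_INR. lra. }
    assert (HLl : INR (length L) <= INR D).
    { apply le_INR. unfold L. rewrite <- (length_seq D (S P)) at 2. apply filter_length_le. }
    rewrite HM'. change (INR 4) with (1 + 1 + 1 + 1). change (INR 1) with 1.
    assert (Hgpos : 0 <= g) by apply pos_INR.
    assert (HD : 0 <= INR D) by apply pos_INR.
    assert (Hcov : INR (length cov) <= INR F * eta).
    { pose proof PI_RGT_0. unfold eta. assert (0 < PI ^ 2) by (apply pow_lt; lra).
      assert (INR F * (8 / PI ^ 2) <= g).
      { apply Rmult_le_reg_r with (PI ^ 2 / 8); [lra|].
        replace (INR F * (8 / PI ^ 2) * (PI ^ 2 / 8)) with (INR F) by (field; lra). lra. }
      lra. }
    assert (Hcov0 : 0 <= INR (length cov)) by apply pos_INR.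
    assert (Hx4 : INR (length cov) * (x / (4 * INR F)) <= eta / 4 * x).
    { apply Rmult_le_reg_r with (4 * INR F); [lra|].
      replace (INR (length cov) * (x / (4 * INR F)) * (4 * INR F))
        with (INR (length cov) * x) by (field; lra). nra. }
    assert (Hx4' : x / (1 + 1 + 1 + 1) * rsum inv_sq L <= x / 4 * delta).
    { replace (1 + 1 + 1 + 1) with 4 by lra. apply Rmult_le_compat_l; lra. }
    nra.
Qed.

(** * Density bounds in the classes modulo 4 *)

Definition sqfree_avoiding (x : R) (A : nat -> Prop) : Prop :=
  1 <= x /\ (forall n, A n -> (1 <= n)%nat /\ INR n <= x) /\
  (forall a b, A a -> A b -> ~ squarefree (a + b)).

Definition cls (A : nat -> Prop) (i n : nat) : Prop := A n /\ (n mod 4 = i)%nat.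

(* [y] is a neighbour of the class [i] when its sums with elements of that class
   are not divisible by 4; odd classes are neighbours of themselves. *)
Definition nbr (A : nat -> Prop) (i y : nat) : Prop := A y /\ ((y + i) mod 4 <> 0)%nat.

Definition mono (q : nat) (P : nat -> Prop) : Prop :=
  forall n n', P n -> P n' -> (Z.of_nat q | Z.of_nat n - Z.of_nat n')%Z.

Definition odd_primes (x : R) (Q : nat -> Prop) : list nat :=
  filter (fun p => classicb (nprime p /\ Q p)) (seq 3 (root_bound x)).

Lemma in_odd_primes (x : R) (Q : nat -> Prop) (p : nat) :
  In p (odd_primes x Q) <->
  (3 <= p < 3 + root_bound x)%nat /\ nprime p /\ Q p.
Proof. unfold odd_primes. now rewrite filter_In, in_seq, classicb_true. Qed.

Lemma length_odd_primes (x : R) (Q : nat -> Prop) :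
  INR (length (odd_primes x Q)) <= INR (root_bound x).
Proof.
  apply le_INR. unfold odd_primes.
  rewrite <- (length_seq (root_bound x) 3) at 2. apply filter_length_le.
Qed.

Lemma odd_primes_sum_le (x : R) (Q : nat -> Prop) (S0 : list nat) :
  (forall p, nprime p -> Q p -> (p = 3 \/ p = 5 \/ p = 7)%nat -> In p S0) ->
  rsum inv_sq (odd_primes x Q) <= rsum inv_sq S0 + 0.0316.
Proof.
  intros H.
  apply Rle_trans with (rsum inv_sq (S0 ++ big_coprime (root_bound x))).
  - apply rsum_incl; [apply inv_sq_nonneg|apply NoDup_filter, seq_NoDup|].
    intros p Hp. apply in_odd_primes in Hp. destruct Hp as [Hp [Hpr HQ]].
    apply in_app_iff.
    destruct (odd_prime_cases p Hpr) as [|[|[|[H11 Hg]]]];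
      try (left; apply H; tauto); [lia|].
    right. apply filter_In. split; [apply in_seq; lia|now apply Nat.eqb_eq].
  - rewrite rsum_app. pose proof (sum_big_coprime (root_bound x)). lra.
Qed.

Lemma inv_sq_small : inv_sq 3 <= 0.11112 /\ inv_sq 5 <= 0.04 /\ inv_sq 7 <= 0.02041.
Proof.
  unfold inv_sq. rewrite !INR_IZR_INZ. simpl Z.of_nat.
  split; [|split]; lra.
Qed.

Lemma odd_primes_sum (x : R) (Q : nat -> Prop) :
  rsum inv_sq (odd_primes x Q) <= 0.2033.
Proof.
  eapply Rle_trans; [apply odd_primes_sum_le with (S0 := [3; 5; 7]%nat)|].
  - simpl. intros p _ _ H. intuition.
  - pose proof inv_sq_small. simpl. lra.
Qed.

Lemma odd_primes_sum_ge5 (x : R) :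
  rsum inv_sq (odd_primes x (fun p => p <> 3%nat)) <= 0.0921.
Proof.
  eapply Rle_trans; [apply odd_primes_sum_le with (S0 := [5; 7]%nat)|].
  - simpl. intros p _ HQ H. intuition.
  - pose proof inv_sq_small. simpl. lra.
Qed.

Lemma odd_primes_sum_ge11 (x : R) :
  rsum inv_sq (odd_primes x (fun p => p <> 3 /\ p <> 5 /\ p <> 7)%nat) <= 0.0316.
Proof.
  eapply Rle_trans; [apply odd_primes_sum_le with (S0 := [])|].
  - simpl. intros p _ HQ H. lia.
  - simpl. lra.
Qed.

Lemma cls_self_nbr (A : nat -> Prop) (i n : nat) :
  (i mod 2 = 1)%nat -> cls A i n -> nbr A i n.
Proof.
  intros Hi [Hn Hni]. split; auto.
  rewrite <- Nat.Div0.add_mod_idemp_l, Hni.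
  pose proof (Nat.mod_upper_bound n 4 ltac:(lia)).
  assert (Hc : (i = 0 \/ i = 1 \/ i = 2 \/ i = 3)%nat) by lia.
  destruct Hc as [->|[->|[->| ->]]]; simpl in *; lia.
Qed.

Lemma cls_nbr_iff (A : nat -> Prop) (i j n : nat) :
  cls A j n -> ((j + i) mod 4 <> 0)%nat -> nbr A i n.
Proof.
  intros [Hn Hj] H. split; auto. now rewrite <- Nat.Div0.add_mod_idemp_l, Hj.
Qed.

Lemma nbr_sum_mod (A : nat -> Prop) (i n y : nat) :
  cls A i n -> nbr A i y -> ((n + y) mod 4 <> 0)%nat.
Proof.
  intros [_ Hi] [_ Hy]. rewrite <- Nat.Div0.add_mod_idemp_l, Hi.
  now rewrite Nat.add_comm.
Qed.

Lemma cross_prime (x : R) (A : nat -> Prop) (i n y : nat) :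
  sqfree_avoiding x A -> cls A i n -> nbr A i y ->
  exists p, nprime p /\ (3 <= p < 3 + root_bound x)%nat /\
    (Z.of_nat (p * p) | Z.of_nat n + Z.of_nat y)%Z.
Proof.
  intros [Hx [Hb Hs]] Hn Hy.
  destruct (not_squarefree_prime (n + y)) as [p [Hp [Hp2 Hd]]].
  - destruct Hn, Hy; auto.
  - now apply nbr_sum_mod with A i.
  - exists p. split; auto. rewrite Nat2Z.inj_add in Hd. split; auto.
    destruct Hn as [Hn _], Hy as [Hy _].
    destruct (Hb n Hn) as [Hn1 Hnx]. destruct (Hb y Hy) as [Hy1 Hyx].
    pose proof (nprime_pos p Hp). split; [lia|].
    assert (p < root_bound x)%nat; [|lia]. apply root_bound_spec; [lra|].
    rewrite <- mult_INR. apply Rle_trans with (INR (n + y)); [|rewrite plus_INR; lra].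
    apply le_INR. apply Z.divide_pos_le in Hd; lia.
Qed.

Lemma prime_sqr_rel_prime (p q : nat) : nprime p -> nprime q -> p <> q ->
  rel_prime (Z.of_nat (p * p)) (Z.of_nat q).
Proof.
  intros Hp Hq Hne. apply rel_prime_sym. rewrite Nat2Z.inj_mul.
  apply rel_prime_mult; apply nprimes_rel_prime; auto.
Qed.

Lemma four_rel_prime (p : nat) : nprime p -> (3 <= p)%nat ->
  rel_prime (Z.of_nat 4) (Z.of_nat p).
Proof. intros. apply (prime_sqr_rel_prime 2 p); auto using nprime_2. lia. Qed.

(** One error term for all the bounds: 12000 exceeds [11025 = 9 * 25 * 49], the largest number of
    residues treated separately by a sieve. *)
Definition err (x : R) : R := 12000 * (INR (root_bound x) + 1).

(* [rho] is a density relative to the residue class [i] modulo 4. *)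
Definition dens (x : R) (A : nat -> Prop) (i : nat) (rho : R) : Prop :=
  card_le (cls A i) (x / 4 * rho + err x).

Lemma err_ge (x : R) : 12000 * INR (root_bound x) + 12000 <= err x.
Proof. unfold err. lra. Qed.

Lemma root_bound_nonneg (x : R) : 0 <= INR (root_bound x).
Proof. apply pos_INR. Qed.

Lemma dens_le (x : R) (A : nat -> Prop) (i : nat) (r r' : R) :
  0 <= x -> dens x A i r -> r <= r' -> dens x A i r'.
Proof.
  intros Hx H Hr. eapply card_le_mono; [exact H|auto|]. nra.
Qed.

Lemma dens_empty (x : R) (A : nat -> Prop) (i : nat) (r : R) :
  0 <= x -> 0 <= r -> (forall n, ~ cls A i n) -> dens x A i r.
Proof.
  intros Hx Hr H. eapply card_le_mono; [now apply card_le_empty|auto|].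
  pose proof (err_ge x). pose proof (root_bound_nonneg x). nra.
Qed.

Lemma dens_mono_class (x : R) (A : nat -> Prop) (i q : nat) :
  sqfree_avoiding x A -> (1 <= q)%nat -> rel_prime (Z.of_nat 4) (Z.of_nat q) ->
  mono q (cls A i) -> dens x A i (/ INR q).
Proof.
  intros [Hx [Hb _]] Hq H4 Hm.
  eapply card_le_mono; [apply (card_le_cong (cls A i) x (4 * q))|auto|].
  - lia.
  - lra.
  - intros n [Hn _]. now apply Hb.
  - intros n n' Hn Hn'. rewrite Nat2Z.inj_mul. apply rel_prime_mul_divide; auto.
    destruct Hn, Hn'. now apply mod4_cong with i.
  - assert (1 <= INR q) by (change 1 with (INR 1); now apply le_INR).
    rewrite mult_INR. change (INR 4) with (1 + 1 + 1 + 1).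
    replace (x / ((1 + 1 + 1 + 1) * INR q)) with (x / 4 * / INR q) by (field; lra).
    pose proof (err_ge x). pose proof (root_bound_nonneg x). lra.
Qed.

(** * Confinement of a class by its neighbours *)

(** As the class has one residue modulo [p0^2], a single sum not divisible by [p0^2] shows that
    [p0^2] divides no [n + y]. Another prime must then serve, which multiplies the density
    [1 / p0^2] by a second sieve factor. *)
Lemma small_class (x : R) (A : nat -> Prop) (i p0 n0 y : nat) :
  sqfree_avoiding x A -> nprime p0 -> (3 <= p0)%nat ->
  mono (p0 * p0) (cls A i) -> cls A i n0 -> nbr A i y ->
  ~ (Z.of_nat (p0 * p0) | Z.of_nat n0 + Z.of_nat y)%Z ->
  dens x A i (inv_sq p0 * rsum inv_sq (odd_primes x (fun p => p <> p0))).
Proof.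
  intros HA Hp0 Hp3 Hm Hn0 Hy Hnd.
  pose proof HA as [Hx [Hb _]].
  eapply card_le_mono;
    [apply (card_le_sieve (cls A i) x (4 * (p0 * p0)) 1 (fun _ => y)
      (odd_primes x (fun p => p <> p0)))|auto|].
  - lra.
  - nia.
  - lia.
  - intros n [Hn _]. now apply Hb.
  - intros n n' Hn Hn'. rewrite (Nat2Z.inj_mul 4). apply rel_prime_mul_divide; auto.
    + rewrite Nat2Z.inj_mul. apply rel_prime_mult; now apply four_rel_prime.
    + destruct Hn, Hn'. now apply mod4_cong with i.
  - apply rel_prime_sym, rel_prime_1.
  - intros d Hd. apply in_odd_primes in Hd. destruct Hd as [Hd [Hdp Hne]].
    split; [lia|]. split; [|apply rel_prime_1].
    apply rel_prime_sym. rewrite Nat2Z.inj_mul.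
    apply rel_prime_mult; apply rel_prime_sym.
    + apply four_rel_prime; auto; lia.
    + apply prime_sqr_rel_prime; auto.
  - intros n Hn. destruct (cross_prime x A i n y HA Hn Hy) as [p [Hp [Hpb Hpd]]].
    exists p. split; auto. apply in_odd_primes. split; auto. split; auto.
    intros ->. apply Hnd.
    replace (Z.of_nat n0 + Z.of_nat y)%Z
      with ((Z.of_nat n + Z.of_nat y) - (Z.of_nat n - Z.of_nat n0))%Z by lia.
    apply Z.divide_sub_r; auto.
  - assert (3 <= INR p0) by (change 3 with (IZR (Z.of_nat 3)); rewrite <- INR_IZR_INZ; now apply le_INR).
    pose proof (length_odd_primes x (fun p => p <> p0)).
    pose proof (err_ge x). pose proof (root_bound_nonneg x).
    unfold inv_sq at 2. rewrite !mult_INR.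
    change (INR 4) with (1 + 1 + 1 + 1). change (INR 1) with 1.
    set (s := rsum inv_sq _).
    replace (x / ((1 + 1 + 1 + 1) * (INR p0 * INR p0)) * s)
      with (x / 4 * (/ (INR p0 * INR p0) * s)) by (field; lra). lra.
Qed.

(** The constant is 1/9 times the sum 0.0921 over the primes from 5 on, rounded up. *)
Lemma small_class_9 (x : R) (A : nat -> Prop) (i n0 y : nat) :
  sqfree_avoiding x A -> mono 9 (cls A i) -> cls A i n0 -> nbr A i y ->
  ~ (9 | Z.of_nat n0 + Z.of_nat y)%Z -> dens x A i 0.01024.
Proof.
  intros HA Hm Hn Hy Hd.
  eapply dens_le;
    [destruct HA; lra|apply (small_class x A i 3 n0 y); auto using nprime_3|].
  pose proof (odd_primes_sum_ge5 x). pose proof inv_sq_small. pose proof (inv_sq_nonneg 3).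
  nra.
Qed.

(** The constant is 1/25 times the sum 0.2033 over all odd primes, rounded up. *)
Lemma small_class_ge5 (x : R) (A : nat -> Prop) (i p0 n0 y : nat) :
  sqfree_avoiding x A -> nprime p0 -> (5 <= p0)%nat ->
  mono (p0 * p0) (cls A i) -> cls A i n0 -> nbr A i y ->
  ~ (Z.of_nat (p0 * p0) | Z.of_nat n0 + Z.of_nat y)%Z -> dens x A i 0.00814.
Proof.
  intros HA Hp H5 Hm Hn Hy Hd.
  eapply dens_le;
    [destruct HA; lra|apply (small_class x A i p0 n0 y); auto; lia|].
  pose proof (odd_primes_sum x (fun p => p <> p0)). pose proof (inv_sq_nonneg p0).
  assert (inv_sq p0 <= 0.04).
  { eapply Rle_trans; [|apply inv_sq_small]. unfold inv_sq.
    assert (INR 5 <= INR p0) by now apply le_INR.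
    assert (0 < INR 5) by (apply lt_0_INR; lia).
    apply Rinv_le_contravar; nra. }
  nra.
Qed.

(** In each residue class modulo 9, at least one of [u] and [v] gives sums not divisible by 9.
    Sieving that class with this shift eliminates the prime 3. *)
Lemma dens_nbr_mod9 (x : R) (A : nat -> Prop) (i u v : nat) :
  sqfree_avoiding x A -> nbr A i u -> nbr A i v ->
  ~ (9 | Z.of_nat u - Z.of_nat v)%Z -> dens x A i 0.0921.
Proof.
  intros HA Hu Hv Huv. pose proof HA as [Hx [Hb _]].
  eapply card_le_mono;
    [apply (card_le_sieve (cls A i) x 4 9
      (fun s => if classicb (9 | Z.of_nat s + Z.of_nat u)%Z then v else u)
      (odd_primes x (fun p => p <> 3%nat)))|auto|].
  - lra.
  - lia.
  - lia.
  - intros n [Hn _]. now apply Hb.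
  - intros n n' [_ Hn] [_ Hn']. now apply mod4_cong with i.
  - now apply Zgcd_1_rel_prime.
  - intros d Hd. apply in_odd_primes in Hd. destruct Hd as [Hd [Hdp Hne]].
    split; [lia|]. split; [apply four_rel_prime; auto; lia|].
    apply (prime_sqr_rel_prime 3); auto using nprime_3.
  - intros n Hn. pose proof (cong_mod 9 n) as Hc. change (Z.of_nat 9) with 9%Z in Hc.
    destruct (classicb _) eqn:He.
    + apply (proj1 (classicb_true _)) in He.
      destruct (cross_prime x A i n v HA Hn Hv) as [p [Hp [Hpb Hpd]]].
      exists p. split; auto. apply in_odd_primes. split; auto. split; auto.
      intros ->. apply Huv.
      replace (Z.of_nat u - Z.of_nat v)%Z
        with ((Z.of_nat (n mod 9) + Z.of_nat u) +
              ((Z.of_nat n - Z.of_nat (n mod 9)) - (Z.of_nat n + Z.of_nat v)))%Z by lia.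
      apply Z.divide_add_r; auto. now apply Z.divide_sub_r.
    + apply (proj1 (classicb_false _)) in He.
      destruct (cross_prime x A i n u HA Hn Hu) as [p [Hp [Hpb Hpd]]].
      exists p. split; auto. apply in_odd_primes. split; auto. split; auto.
      intros ->. apply He.
      replace (Z.of_nat (n mod 9) + Z.of_nat u)%Z
        with ((Z.of_nat n + Z.of_nat u) - (Z.of_nat n - Z.of_nat (n mod 9)))%Z by lia.
      now apply Z.divide_sub_r.
  - pose proof (odd_primes_sum_ge5 x).
    pose proof (length_odd_primes x (fun p => p <> 3%nat)).
    pose proof (err_ge x). pose proof (root_bound_nonneg x).
    change (INR 4) with (1 + 1 + 1 + 1). replace (1 + 1 + 1 + 1) with 4 by lra.
    replace (INR 9) with 9 by (rewrite INR_IZR_INZ; reflexivity). nra.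
Qed.

Lemma two_hits (x : R) (A : nat -> Prop) (i q q' y y' : nat) :
  sqfree_avoiding x A -> (1 <= q)%nat -> (1 <= q')%nat ->
  rel_prime (Z.of_nat 4) (Z.of_nat q) -> rel_prime (Z.of_nat 4) (Z.of_nat q') ->
  rel_prime (Z.of_nat q) (Z.of_nat q') ->
  card_le (fun n => cls A i n /\ (Z.of_nat q | Z.of_nat n + Z.of_nat y)%Z /\
     (Z.of_nat q' | Z.of_nat n + Z.of_nat y')%Z) (x / 4 * / INR (q * q') + 1).
Proof.
  intros [Hx [Hb _]] Hq Hq' H4 H4' Hqq.
  eapply card_le_mono; [apply (card_le_cong (fun n => cls A i n /\
     (Z.of_nat q | Z.of_nat n + Z.of_nat y)%Z /\
     (Z.of_nat q' | Z.of_nat n + Z.of_nat y')%Z) x (4 * (q * q')))|auto|].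
  - nia.
  - lra.
  - intros n [[Hn _] _]. now apply Hb.
  - intros n n' [[_ Hn] [Hd Hd']] [[_ Hn'] [He He']].
    rewrite !Nat2Z.inj_mul. apply rel_prime_mul_divide; [now apply rel_prime_mult| |].
    + now apply mod4_cong with i.
    + apply rel_prime_mul_divide; auto.
      * replace (Z.of_nat n - Z.of_nat n')%Z
          with ((Z.of_nat n + Z.of_nat y) - (Z.of_nat n' + Z.of_nat y))%Z by lia.
        now apply Z.divide_sub_r.
      * replace (Z.of_nat n - Z.of_nat n')%Z
          with ((Z.of_nat n + Z.of_nat y') - (Z.of_nat n' + Z.of_nat y'))%Z by lia.
        now apply Z.divide_sub_r.
  - assert (0 < INR (q * q')) by (apply lt_0_INR; nia).
    rewrite (mult_INR 4). change (INR 4) with (1 + 1 + 1 + 1).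
    right. field. lra.
Qed.

Definition hit (q n y : nat) : Prop := (Z.of_nat q | Z.of_nat n + Z.of_nat y)%Z.

Lemma hit_diff (q n u v : nat) :
  hit q n u -> hit q n v -> (Z.of_nat q | Z.of_nat u - Z.of_nat v)%Z.
Proof.
  unfold hit. intros H H'.
  replace (Z.of_nat u - Z.of_nat v)%Z
    with ((Z.of_nat n + Z.of_nat u) - (Z.of_nat n + Z.of_nat v))%Z by lia.
  now apply Z.divide_sub_r.
Qed.

Lemma hit_cong (q n n' y : nat) :
  (Z.of_nat q | Z.of_nat n - Z.of_nat n')%Z -> hit q n y -> hit q n' y.
Proof.
  unfold hit. intros H H'.
  replace (Z.of_nat n' + Z.of_nat y)%Z
    with ((Z.of_nat n + Z.of_nat y) - (Z.of_nat n - Z.of_nat n'))%Z by lia.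
  now apply Z.divide_sub_r.
Qed.

Definition small_hit (n y : nat) : Prop := hit 9 n y \/ hit 25 n y \/ hit 49 n y.

Definition small_modulus : nat := (9 * (25 * 49))%nat.

Lemma small_modulus_Z : Z.of_nat small_modulus = 11025%Z.
Proof. unfold small_modulus. now rewrite !Nat2Z.inj_mul. Qed.

Lemma small_hit_cong (n n' y : nat) :
  (Z.of_nat small_modulus | Z.of_nat n - Z.of_nat n')%Z -> small_hit n y -> small_hit n' y.
Proof.
  intros H [H'|[H'|H']]; [left|right; left|right; right];
    (eapply hit_cong; [|exact H']); (eapply Z.divide_trans; [|exact H]); rewrite small_modulus_Z.
  - now exists 1225%Z.
  - now exists 441%Z.
  - now exists 225%Z.
Qed.

(* A class modulo [11025 = 9 * 25 * 49] in which [u], [v] and [w] are all hit by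
   a small square lies in one of six classes; in any other class, one of the
   three shifts must be hit by the square of a prime [p >= 11]. *)
Lemma dens_nbr_three (x : R) (A : nat -> Prop) (i u v w : nat) :
  sqfree_avoiding x A -> nbr A i u -> nbr A i v -> nbr A i w ->
  ~ (Z.of_nat 9 | Z.of_nat u - Z.of_nat v)%Z ->
  ~ (Z.of_nat 25 | Z.of_nat u - Z.of_nat v)%Z ->
  ~ (Z.of_nat 49 | Z.of_nat u - Z.of_nat w)%Z -> dens x A i 0.04666.
Proof.
  intros HA Hu Hv Hw H9 H25 H49. pose proof HA as [Hx [Hb _]].
  assert (Hgood : card_le (fun n => cls A i n /\
      ~ (small_hit n u /\ small_hit n v /\ small_hit n w))
    (x / INR 4 * rsum inv_sq (odd_primes x (fun p => p <> 3 /\ p <> 5 /\ p <> 7)%nat) +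
     INR (length (odd_primes x (fun p => p <> 3 /\ p <> 5 /\ p <> 7)%nat)) * INR small_modulus)).
  (* The residue selects a shift with no small hit: [u] if possible, then [v], then [w]. *)
  { apply card_le_sieve with (a := fun s =>
       if classicb (small_hit s u) then if classicb (small_hit s v) then w else v else u).
    - lra.
    - lia.
    - pose proof small_modulus_Z. lia.
    - intros n [[Hn _] _]. now apply Hb.
    - intros n n' [[_ Hn] _] [[_ Hn'] _]. now apply mod4_cong with i.
    - rewrite small_modulus_Z. now apply Zgcd_1_rel_prime.
    - intros d Hd. apply in_odd_primes in Hd. destruct Hd as [Hd [Hdp [H3 [H5 H7]]]].
      split; [lia|]. split; [apply four_rel_prime; auto; lia|].
      replace (Z.of_nat small_modulus) with (Z.of_nat (3 * 3) * (Z.of_nat (5 * 5) * Z.of_nat (7 * 7)))%Z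
        by (now rewrite small_modulus_Z).
      apply rel_prime_sym; repeat apply rel_prime_mult; apply rel_prime_sym;
        apply prime_sqr_rel_prime; auto using nprime_3, nprime_5, nprime_7.
    - intros n [Hn Hns].
      assert (Hkey : forall y, nbr A i y -> ~ small_hit n y -> exists d,
         In d (odd_primes x (fun p => p <> 3 /\ p <> 5 /\ p <> 7)%nat) /\
         (Z.of_nat (d * d) | Z.of_nat n + Z.of_nat y)%Z).
      { intros y Hy Hny. destruct (cross_prime x A i n y HA Hn Hy) as [p [Hp [Hpb Hpd]]].
        exists p. split; auto. apply in_odd_primes. split; auto. split; auto.
        unfold small_hit, hit in Hny. split; [|split]; intros ->; tauto. }
      pose proof (cong_mod small_modulus n) as Hc.
      assert (Hc' : (Z.of_nat small_modulus | Z.of_nat (n mod small_modulus) - Z.of_nat n)%Z).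
      { apply Z.divide_opp_r in Hc.
        now replace (Z.of_nat (n mod small_modulus) - Z.of_nat n)%Z
          with (- (Z.of_nat n - Z.of_nat (n mod small_modulus)))%Z by lia. }
      destruct (classicb (small_hit (n mod small_modulus) u)) eqn:E1;
        [destruct (classicb (small_hit (n mod small_modulus) v)) eqn:E2|].
      + apply Hkey; auto. apply (proj1 (classicb_true _)) in E1, E2.
        apply (small_hit_cong _ _ _ Hc') in E1, E2. intros H; apply Hns; auto.
      + apply Hkey; auto. apply (proj1 (classicb_false _)) in E2. intros H; apply E2.
        now apply (small_hit_cong n).
      + apply Hkey; auto. apply (proj1 (classicb_false _)) in E1. intros H; apply E1.
        now apply (small_hit_cong n). }
  pose proof (fun q q' y y' => two_hits x A i q q' y y' HA) as H2.
  assert (R4 : rel_prime (Z.of_nat 4) (Z.of_nat 9) /\ rel_prime (Z.of_nat 4) (Z.of_nat 25)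
     /\ rel_prime (Z.of_nat 4) (Z.of_nat 49))
    by (split; [|split]; apply gcd_rel_prime; reflexivity).
  assert (Rq : rel_prime (Z.of_nat 9) (Z.of_nat 25) /\ rel_prime (Z.of_nat 9) (Z.of_nat 49)
     /\ rel_prime (Z.of_nat 25) (Z.of_nat 49))
    by (split; [|split]; apply gcd_rel_prime; reflexivity).
  destruct R4 as [R9 [R25 R49]], Rq as [S1 [S2 S3]].
  (* If [u] is hit by 9 or 25, then [v] is hit by one of the other two squares; if [u] is hit by 49,
     then [w] is hit by 9 or 25. The six densities sum to [2/225 + 2/441 + 2/1225], which with
     0.0316 makes 0.04666. *)
  pose proof (H2 9 25 u v ltac:(lia) ltac:(lia) R9 R25 S1)%nat as B1.
  pose proof (H2 9 25 v u ltac:(lia) ltac:(lia) R9 R25 S1)%nat as B2.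
  pose proof (H2 9 49 u v ltac:(lia) ltac:(lia) R9 R49 S2)%nat as B3.
  pose proof (H2 9 49 w u ltac:(lia) ltac:(lia) R9 R49 S2)%nat as B4.
  pose proof (H2 25 49 u v ltac:(lia) ltac:(lia) R25 R49 S3)%nat as B5.
  pose proof (H2 25 49 w u ltac:(lia) ltac:(lia) R25 R49 S3)%nat as B6.
  pose proof (card_le_union _ _ _ _ Hgood (card_le_union _ _ _ _ B1
    (card_le_union _ _ _ _ B2 (card_le_union _ _ _ _ B3 (card_le_union _ _ _ _ B4
    (card_le_union _ _ _ _ B5 B6)))))) as HB.
  eapply card_le_mono; [exact HB| |].
  - intros n Hn.
    destruct (classic (small_hit n u /\ small_hit n v /\ small_hit n w)) as [[Su [Sv Sw]]|];
      [right|now left].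
    assert (N9 : ~ (hit 9 n u /\ hit 9 n v)) by (intros [a b]; apply H9, (hit_diff 9 n); auto).
    assert (N25 : ~ (hit 25 n u /\ hit 25 n v)) by (intros [a b]; apply H25, (hit_diff 25 n); auto).
    assert (N49 : ~ (hit 49 n u /\ hit 49 n w)) by (intros [a b]; apply H49, (hit_diff 49 n); auto).
    unfold hit in *.
    destruct Su as [U|[U|U]].
    + destruct Sv as [V|[V|V]]; [tauto|now left|now do 2 right; left].
    + destruct Sv as [V|[V|V]]; [now right; left|tauto|now do 4 right; left].
    + destruct Sw as [W|[W|W]]; [now do 3 right; left|now do 5 right|tauto].
  - pose proof (odd_primes_sum_ge11 x).
    pose proof (length_odd_primes x (fun p => p <> 3 /\ p <> 5 /\ p <> 7)%nat).
    pose proof (err_ge x). pose proof (root_bound_nonneg x).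
    rewrite !INR_IZR_INZ in *. rewrite !Nat2Z.inj_mul.
    rewrite small_modulus_Z.
    simpl (Z.of_nat 4). simpl (Z.of_nat 9). simpl (Z.of_nat 25). simpl (Z.of_nat 49).
    rewrite !mult_IZR. set (s := rsum inv_sq _) in *.
    assert (x / 4 * s <= x / 4 * 0.0316) by (apply Rmult_le_compat_l; lra).
    lra.
Qed.

(** Two equivalence relations cannot together relate all pairs unless one of them does so alone.
    With [q = q'] this merely extracts an incongruent pair. *)
Lemma two_residues (P : nat -> Prop) (q q' : nat) :
  ~ mono q P -> ~ mono q' P -> exists u v, P u /\ P v /\
    ~ (Z.of_nat q | Z.of_nat u - Z.of_nat v)%Z /\
    ~ (Z.of_nat q' | Z.of_nat u - Z.of_nat v)%Z.
Proof.
  intros H H'. apply NNPP. intros Hno.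
  assert (Hor : forall u v, P u -> P v -> (Z.of_nat q | Z.of_nat u - Z.of_nat v)%Z \/
      (Z.of_nat q' | Z.of_nat u - Z.of_nat v)%Z).
  { intros u v Hu Hv. apply NNPP. intros Hn. apply Hno. exists u, v. tauto. }
  apply H. intros a b Ha Hb.
  destruct (Hor a b Ha Hb) as [|Hab]; auto.
  apply NNPP. intros Hn. apply H'. intros c d Hc Hd.
  assert (Hae : forall e, P e -> (Z.of_nat q' | Z.of_nat a - Z.of_nat e)%Z).
  { intros e He. destruct (Hor a e Ha He) as [Hae|]; auto.
    destruct (Hor b e Hb He) as [Hbe|Hbe].
    - exfalso. apply Hn.
      replace (Z.of_nat a - Z.of_nat b)%Z
        with ((Z.of_nat a - Z.of_nat e) - (Z.of_nat b - Z.of_nat e))%Z by lia.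
      now apply Z.divide_sub_r.
    - replace (Z.of_nat a - Z.of_nat e)%Z
        with ((Z.of_nat a - Z.of_nat b) + (Z.of_nat b - Z.of_nat e))%Z by lia.
      now apply Z.divide_add_r. }
  replace (Z.of_nat c - Z.of_nat d)%Z
    with ((Z.of_nat a - Z.of_nat d) - (Z.of_nat a - Z.of_nat c))%Z by lia.
  apply Z.divide_sub_r; auto.
Qed.

Lemma not_mono_from (P : nat -> Prop) (q u : nat) :
  ~ mono q P -> P u -> exists w, P w /\ ~ (Z.of_nat q | Z.of_nat u - Z.of_nat w)%Z.
Proof.
  intros H Hu. apply NNPP. intros Hno. apply H. intros c d Hc Hd.
  assert (He : forall e, P e -> (Z.of_nat q | Z.of_nat u - Z.of_nat e)%Z).
  { intros e He. apply NNPP. intros Hn. apply Hno. eauto. }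
  replace (Z.of_nat c - Z.of_nat d)%Z
    with ((Z.of_nat u - Z.of_nat d) - (Z.of_nat u - Z.of_nat c))%Z by lia.
  apply Z.divide_sub_r; auto.
Qed.

Lemma locked_mono (A : nat -> Prop) (i q y : nat) : nbr A i y ->
  (forall n y, cls A i n -> nbr A i y -> (Z.of_nat q | Z.of_nat n + Z.of_nat y)%Z) ->
  mono q (cls A i).
Proof.
  intros Hy H n n' Hn Hn'.
  replace (Z.of_nat n - Z.of_nat n')%Z
    with ((Z.of_nat n + Z.of_nat y) - (Z.of_nat n' + Z.of_nat y))%Z by lia.
  apply Z.divide_sub_r; auto.
Qed.

(** If all sums are divisible by [p0^2], the class [i] has one residue and density at most 1/25.
    Otherwise some [z] of the class [i] has a sum not divisible by [p0^2]; every class [j] of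
    neighbours has one residue modulo [p0^2], and [z] is a neighbour incompatible with it. *)
Lemma dens_nbr_mono_ge5 (x : R) (A : nat -> Prop) (i p0 y0 : nat) :
  sqfree_avoiding x A -> nprime p0 -> (5 <= p0)%nat -> nbr A i y0 ->
  mono (p0 * p0) (nbr A i) ->
  dens x A i 0.04 \/
  (forall j, ((j + i) mod 4 <> 0)%nat -> dens x A j 0.00814).
Proof.
  intros HA Hp H5 Hy0 Hm.
  destruct (classic (forall n y, cls A i n -> nbr A i y ->
     (Z.of_nat (p0 * p0) | Z.of_nat n + Z.of_nat y)%Z)) as [Hl|Hl].
  - left. eapply dens_le; [destruct HA; lra|apply (dens_mono_class x A i (p0 * p0))|]; auto.
    + nia.
    + rewrite Nat2Z.inj_mul. apply rel_prime_mult; apply four_rel_prime; auto; lia.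
    + now apply locked_mono with y0.
    + assert (INR 5 <= INR p0) by now apply le_INR.
      rewrite mult_INR. replace 0.04 with (/ (INR 5 * INR 5))
        by (rewrite INR_IZR_INZ; simpl; lra).
      assert (0 < INR 5) by (apply lt_0_INR; lia).
      apply Rinv_le_contravar; nra.
  - right. intros j Hj.
    apply not_all_ex_not in Hl. destruct Hl as [z Hl].
    apply not_all_ex_not in Hl. destruct Hl as [y Hl].
    apply imply_to_and in Hl. destruct Hl as [Hz Hl].
    apply imply_to_and in Hl. destruct Hl as [Hy Hl].
    destruct (classic (exists n, cls A j n)) as [[n Hn]|He].
    + assert (Hsub : forall n, cls A j n -> nbr A i n) by (intros; now apply cls_nbr_iff with j).
      apply (small_class_ge5 x A j p0 n z); auto.
      * intros a b Ha Hb'. apply Hm; auto.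
      * apply cls_nbr_iff with i; auto. now rewrite Nat.add_comm.
      * intros Hd. apply Hl.
        replace (Z.of_nat z + Z.of_nat y)%Z
          with ((Z.of_nat n + Z.of_nat z) - (Z.of_nat n - Z.of_nat y))%Z by lia.
        apply Z.divide_sub_r; auto.
    + apply dens_empty; [destruct HA; lra|lra|]. intros n Hn. apply He; eauto.
Qed.

(** If the neighbours also meet two residues modulo 25 and modulo 49, three suitable shifts exist.
    If they have one residue modulo 25 or 49, either the class [i] or all the classes of its
    neighbours become thin. *)
Lemma dens_nbr_not_mono (x : R) (A : nat -> Prop) (i : nat) :
  sqfree_avoiding x A -> ~ mono 9 (nbr A i) ->
  dens x A i 0.04666 \/
  (dens x A i 0.0921 /\ forall j, ((j + i) mod 4 <> 0)%nat -> dens x A j 0.00814).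
Proof.
  intros HA H9. pose proof HA as [Hx _].
  destruct (two_residues _ 9 9 H9 H9) as [y0 [v0 [Hy0 [Hv0 [H90 _]]]]].
  assert (Hd : dens x A i 0.0921) by now apply (dens_nbr_mod9 x A i y0 v0).
  assert (Hred : forall p0, nprime p0 -> (5 <= p0)%nat -> mono (p0 * p0) (nbr A i) ->
     dens x A i 0.04666 \/
     (dens x A i 0.0921 /\ forall j, ((j + i) mod 4 <> 0)%nat -> dens x A j 0.00814)).
  { intros p0 Hp H5 Hm.
    destruct (dens_nbr_mono_ge5 x A i p0 y0 HA Hp H5 Hy0 Hm) as [H|H]; [left|now right].
    eapply dens_le; [lra|exact H|lra]. }
  destruct (classic (mono 25 (nbr A i))) as [H25|H25];
    [apply (Hred 5%nat); auto using nprime_5|].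
  destruct (classic (mono 49 (nbr A i))) as [H49|H49];
    [apply (Hred 7%nat); auto using nprime_7; lia|].
  left. destruct (two_residues _ 9 25 H9 H25) as [u [v [Hu [Hv [Hu9 Hu25]]]]].
  destruct (not_mono_from _ 49 u H49 Hu) as [w [Hw Hu49]].
  now apply (dens_nbr_three x A i u v w).
Qed.

Lemma nbr_odd_square_shift (x : R) (A : nat -> Prop) (i b n : nat) :
  sqfree_avoiding x A -> nbr A i b -> cls A i n -> odd_square_shift x b i n.
Proof.
  intros HA Hb Hn. pose proof HA as [_ [Hx _]].
  destruct (cross_prime x A i n b HA Hn Hb) as [p [Hp [Hpb Hpd]]].
  destruct Hn as [Hn Hni]. split; [now apply Hx|]. split; auto.
  exists p. split; [lia|]. split; auto.
  destruct (Nat.Even_or_Odd p) as [[k ->]|]; auto. exfalso.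
  apply (nprime_not_composite _ 2 Hp); [lia|]. exists (Z.of_nat k). lia.
Qed.

(** * The loss due to two incongruent neighbours *)

Lemma class_progression (q b i : nat) : (1 <= q)%nat -> Nat.Odd q -> (i < 4)%nat ->
  exists n0, (n0 < 4 * (q * q))%nat /\ (n0 mod 4 = i)%nat /\
    (Z.of_nat (q * q) | Z.of_nat n0 + Z.of_nat b)%Z.
Proof.
  intros Hq1 Hq Hi.
  set (Q := Z.of_nat (q * q)). assert (HQ : (1 <= Q)%Z) by (unfold Q; nia).
  assert (HQ4 : exists k, (Q = 4 * k + 1)%Z).
  { destruct Hq as [k ->]. exists (Z.of_nat (k * k + k)). unfold Q. lia. }
  destruct HQ4 as [k Hk].
  (* As [Q] is 1 modulo 4, this [z] is [i] modulo 4 and [-b] modulo [Q]. *)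
  set (z := (- Z.of_nat b + Q * (Z.of_nat i + Z.of_nat b))%Z).
  pose proof (Z.mod_pos_bound z (4 * Q) ltac:(lia)) as Hz.
  pose proof (Z.div_mod z (4 * Q) ltac:(lia)) as Hdm.
  set (r := (z mod (4 * Q))%Z) in *. set (t := (z / (4 * Q))%Z) in *.
  exists (Z.to_nat r). split; [unfold Q in *; lia|]. split.
  - assert (H4 : (r = Z.of_nat i + 4 * (k * (Z.of_nat i + Z.of_nat b) - Q * t))%Z).
    { unfold z in Hdm. rewrite Hk in Hdm at 1. lia. }
    pose proof (Nat.div_mod_eq (Z.to_nat r) 4).
    pose proof (Nat.mod_upper_bound (Z.to_nat r) 4). lia.
  - rewrite Z2Nat.id by lia. exists (Z.of_nat i + Z.of_nat b - 4 * t)%Z.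
    fold Q. unfold z in Hdm. lia.
Qed.

(* The [n] in the progression [n = i mod 4], [n = -b mod q^2] for which [n + b']
   is free of odd squares are counted by the shift [b] but excluded by [b']. *)
Lemma two_shift_loss (x : R) (A : nat -> Prop) (i q b b' : nat) (B : R) :
  sqfree_avoiding x A -> nprime q -> (3 <= q)%nat -> (i < 4)%nat ->
  nbr A i b -> nbr A i b' ->
  ~ (Z.of_nat (q * q) | Z.of_nat b - Z.of_nat b')%Z ->
  card_le (odd_square_shift x b i) B ->
  card_le (cls A i) (B - x / 4 * inv_sq q * 0.7967 + err x).
Proof.
  intros HA Hq Hq3 Hi Hb Hb' Hbb HB l Hl Hin.
  pose proof HA as [Hx [HAx _]].
  assert (Hqo : Nat.Odd q).
  { destruct (Nat.Even_or_Odd q) as [[k ->]|]; auto. exfalso.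
    apply (nprime_not_composite _ 2 Hq); [lia|]. exists (Z.of_nat k). lia. }
  destruct (class_progression q b i) as [n0 [Hn0 [Hn0i Hn0b]]]; [lia|auto|auto|].
  set (G := (4 * (q * q))%nat) in *.
  assert (HG : (1 <= G)%nat) by (unfold G; nia).
  assert (HG' : 0 < INR G) by (apply lt_0_INR; lia).
  (* Number of full periods up to [x]: since [n0 < G], the terms [n0 + G * k] with [k < K] are all
     at most [x]. *)
  set (K := Z.to_nat (Int_part (x / INR G))).
  assert (HxG : 0 <= x / INR G) by (apply Rlt_le, Rdiv_lt_0_compat; lra).
  assert (HK : x / INR G - 1 <= INR K <= x / INR G).
  { destruct (base_Int_part (x / INR G)) as [K1 K2]. unfold K.
    assert (-1 < Int_part (x / INR G))%Z.
    { apply lt_IZR. lra. }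
    rewrite (INR_IZR_INZ (Z.to_nat _)), Z2Nat.id by lia. lra. }
  set (V := map (fun k => n0 + G * k)%nat (seq 0 K)).
  assert (HVnd : NoDup V).
  { apply NoDup_map_NoDup_ForallPairs; [|apply seq_NoDup]. intros a c _ _ H. nia. }
  assert (HV : forall n, In n V -> INR n <= x /\ (n mod 4 = i)%nat /\
     (Z.of_nat (q * q) | Z.of_nat n + Z.of_nat b)%Z /\
     exists k, n = (n0 + G * k)%nat).
  { intros n Hn. apply in_map_iff in Hn. destruct Hn as [k [<- Hk]]. apply in_seq in Hk.
    split; [|split; [|split]].
    - apply Rle_trans with (INR (G * K)); [apply le_INR; nia|].
      rewrite mult_INR. apply Rle_trans with (INR G * (x / INR G)).
      + apply Rmult_le_compat_l; lra.
      + right. field. lra.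
    - unfold G. replace (n0 + 4 * (q * q) * k)%nat with (n0 + q * q * k * 4)%nat by lia.
      now rewrite Nat.Div0.mod_add.
    - unfold G. replace (Z.of_nat (n0 + 4 * (q * q) * k) + Z.of_nat b)%Z
        with ((Z.of_nat n0 + Z.of_nat b) + Z.of_nat (q * q) * (4 * Z.of_nat k))%Z by lia.
      apply Z.divide_add_r; auto. apply Z.divide_factor_l.
    - eauto. }
  set (L := odd_primes x (fun p => p <> q)).
  set (f := fun n => classicb (exists d, In d L /\
     (Z.of_nat (d * d) | Z.of_nat n + Z.of_nat b')%Z)).
  assert (Hcov : INR (length (filter f V)) <=
    x / INR G * rsum inv_sq L + INR (length L) * INR 1).
  { apply (card_le_sieve (fun n => In n V /\ f n = true) x G 1 (fun _ => b') L); auto; try lra.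
    - now intros n [Hn _]; apply HV.
    - intros n n' [Hn _] [Hn' _]. destruct (HV n Hn) as [_ [_ [_ [k ->]]]].
      destruct (HV n' Hn') as [_ [_ [_ [k' ->]]]].
      exists (Z.of_nat k - Z.of_nat k')%Z. lia.
    - apply rel_prime_sym, rel_prime_1.
    - intros d Hd. apply in_odd_primes in Hd. destruct Hd as [Hd [Hdp Hne]].
      split; [lia|]. split; [|apply rel_prime_1]. unfold G.
      apply rel_prime_sym. rewrite (Nat2Z.inj_mul 4).
      apply rel_prime_mult; apply rel_prime_sym.
      + apply four_rel_prime; auto; lia.
      + apply prime_sqr_rel_prime; auto.
    - intros n [_ Hf]. now apply (proj1 (classicb_true _)) in Hf.
    - now apply NoDup_filter.
    - intros n Hn. now apply filter_In in Hn. }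
  (* In the progression [q^2] divides [n + b], hence not [n + b']. So [W] avoids the class of [A],
     and it keeps a proportion at least [1 - 0.2033 = 0.7967] of the progression, up to errors. *)
  set (W := filter (fun n => negb (f n)) V).
  assert (HW : (length (filter f V) + length W = K)%nat).
  { unfold W. rewrite filter_length_compl. unfold V. now rewrite length_map, length_seq. }
  apply f_equal with (f := INR) in HW. rewrite plus_INR in HW.
  assert (HlW : INR (length (l ++ W)) <= B).
  { apply HB.
    - apply NoDup_app; auto; [now apply NoDup_filter|].
      intros n Hn HnW. apply filter_In in HnW. destruct HnW as [HnV Hnf].
      apply Bool.negb_true_iff, (proj1 (classicb_false _)) in Hnf. apply Hnf.
      destruct (cross_prime x A i n b' HA (Hin n Hn) Hb') as [p [Hp [Hpb Hpd]]].
      exists p. split; auto. apply in_odd_primes. split; auto. split; auto.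
      intros ->. apply Hbb.
      destruct (HV n HnV) as [_ [_ [Hnq _]]]. now apply (hit_diff (q * q) n).
    - intros n Hn. apply in_app_iff in Hn. destruct Hn as [Hn|Hn].
      + now apply nbr_odd_square_shift with A; auto.
      + apply filter_In in Hn. destruct Hn as [Hn _].
        destruct (HV n Hn) as [H1 [H2 [H3 _]]]. split; auto. split; auto.
        exists q. auto. }
  rewrite length_app, plus_INR in HlW.
  assert (Hq' : 0 < INR q) by (apply lt_0_INR; lia).
  assert (HGx : x / INR G = x / 4 * inv_sq q).
  { unfold G, inv_sq. rewrite !mult_INR. change (INR 4) with (1 + 1 + 1 + 1). field. lra. }
  pose proof (odd_primes_sum x (fun p => p <> q)) as Hs. fold L in Hs.
  pose proof (length_odd_primes x (fun p => p <> q)) as HLl. fold L in HLl.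
  pose proof (err_ge x). pose proof (root_bound_nonneg x).
  change (INR 1) with 1 in *. rewrite HGx in *.
  assert (x / 4 * inv_sq q * rsum inv_sq L <= x / 4 * inv_sq q * 0.2033)
    by (apply Rmult_le_compat_l; auto).
  lra.
Qed.

Lemma card_le_total (x : R) (A : nat -> Prop) (b : nat -> R) :
  (forall i, (i < 4)%nat -> card_le (cls A i) (b i)) ->
  card_le A (b 0%nat + b 1%nat + b 2%nat + b 3%nat).
Proof.
  intros H.
  eapply card_le_mono;
    [apply (card_le_Union (fun i => cls A i) b (seq 0 4))| |simpl; lra].
  - intros i Hi. apply in_seq in Hi. apply H. lia.
  - intros n Hn. exists (n mod 4)%nat. split; [|now split].
    apply in_seq. pose proof (Nat.mod_upper_bound n 4). lia.
Qed.

(** * Structured and sparse sets *)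

Definition structured (A : nat -> Prop) : Prop :=
  (forall n, A n -> (n mod 4 = 0)%nat) \/
  (forall n, A n -> (n mod 9 = 0)%nat) \/
  (forall n, A n -> (n mod 4 = 2)%nat) \/
  ((forall n, A n -> Nat.Even n) /\
   exists a : nat, (1 <= a <= 8)%nat /\
     forall n, A n ->
       (n mod 4 = 2 <-> n mod 9 = a)%nat /\
       (n mod 4 = 0 <-> (n + a) mod 9 = 0)%nat).

Lemma divide9_mod (n : nat) : (9 | Z.of_nat n)%Z <-> (n mod 9 = 0)%nat.
Proof.
  change 9%Z with (Z.of_nat 9). rewrite <- nat_divide_Z. symmetry.
  apply Nat.Lcm0.mod_divide.
Qed.

Lemma two_divide9 (n : nat) : (9 | Z.of_nat n + Z.of_nat n)%Z -> (9 | Z.of_nat n)%Z.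
Proof.
  intros H. apply Gauss with 2%Z.
  - now replace (2 * Z.of_nat n)%Z with (Z.of_nat n + Z.of_nat n)%Z by lia.
  - now apply Zgcd_1_rel_prime.
Qed.

Lemma divide9_cancel (n y : nat) : (9 | Z.of_nat n + Z.of_nat y)%Z ->
  ((9 | Z.of_nat n) <-> (9 | Z.of_nat y))%Z.
Proof.
  intros H. split; intros H'.
  - now apply (Z.divide_add_cancel_r _ (Z.of_nat n)).
  - apply (Z.divide_add_cancel_r _ (Z.of_nat y)); auto. now rewrite Z.add_comm.
Qed.

(** [a] is the residue modulo 9 of the class 2, and the class 0 then has residue [-a]. Both
    equivalences hold because [a] and [-a] differ modulo 9 when [a] is nonzero. *)
Lemma even_classes_structured (A : nat -> Prop) (n0 n2 : nat) :
  (forall n, A n -> Nat.Even n) -> cls A 0 n0 -> cls A 2 n2 ->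
  (forall n m, cls A 0 n -> cls A 2 m -> (9 | Z.of_nat n + Z.of_nat m)%Z) ->
  ~ (9 | Z.of_nat n2)%Z -> structured A.
Proof.
  intros He H0 H2 Hl Hn. do 3 right. split; auto.
  exists (n2 mod 9)%nat. rewrite divide9_mod in Hn.
  pose proof (Nat.mod_upper_bound n2 9).
  split; [lia|]. intros n HAn.
  assert (Hl' : forall n m, cls A 0 n -> cls A 2 m -> ((n + m) mod 9 = 0)%nat).
  { intros a c Ha Hc. apply divide9_mod. rewrite Nat2Z.inj_add. now apply Hl. }
  pose proof (Hl' n0 n2 H0 H2) as H02.
  destruct (He n HAn) as [k Hk].
  pose proof (Nat.div_mod_eq n 4). pose proof (Nat.mod_upper_bound n 4).
  pose proof (Nat.div_mod_eq n 9). pose proof (Nat.mod_upper_bound n 9).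
  pose proof (Nat.div_mod_eq n2 9).
  pose proof (Nat.div_mod_eq (n0 + n2) 9).
  pose proof (Nat.div_mod_eq (n + n2 mod 9) 9).
  pose proof (Nat.mod_upper_bound (n + n2 mod 9) 9).
  assert (Hc : (n mod 4 = 0 \/ n mod 4 = 2)%nat) by lia.
  destruct Hc as [Hc|Hc].
  - pose proof (Hl' n n2 (conj HAn Hc) H2). pose proof (Nat.div_mod_eq (n + n2) 9). lia.
  - pose proof (Hl' n0 n H0 (conj HAn Hc)). pose proof (Nat.div_mod_eq (n0 + n) 9). lia.
Qed.

Definition locked (A : nat -> Prop) (i : nat) : Prop :=
  forall n y, cls A i n -> nbr A i y -> (Z.of_nat 9 | Z.of_nat n + Z.of_nat y)%Z.

(** Since [0.1867 <= eta], this puts the size of [A] below [delta0 * x] up to the error, which the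
    hypothesis on the size excludes. *)
Definition sparse (x : R) (A : nat -> Prop) : Prop :=
  card_le A (x / 4 * 0.1867 + 4 * err x).

Lemma sparse_of_dens (x : R) (A : nat -> Prop) (rho : nat -> R) :
  0 <= x -> (forall j, (j < 4)%nat -> dens x A j (rho j)) ->
  rho 0%nat + rho 1%nat + rho 2%nat + rho 3%nat <= 0.1867 -> sparse x A.
Proof.
  intros Hx H Hr. eapply card_le_mono;
    [apply (card_le_total x A (fun j => x / 4 * rho j + err x)); exact H|auto|]. nra.
Qed.

(** * Case analysis *)

Lemma lt_4_cases (i : nat) : (i < 4)%nat ->
  i = 0%nat \/ i = 1%nat \/ i = 2%nat \/ i = 3%nat.
Proof. lia. Qed.

(** Every element is in the class [i] or a neighbour of it, so divisibility by 9 holds for all of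
    [A] or for none. In the second case all neighbours share one nonzero residue: an odd element
    makes the other three classes thin, with total density at most [1/9 + 3 * 0.01024], and without
    one the two even classes have opposite residues. *)
Lemma locked_even (x : R) (A : nat -> Prop) (i n0 y0 : nat) :
  sqfree_avoiding x A -> (i = 0 \/ i = 2)%nat -> locked A i ->
  cls A i n0 -> nbr A i y0 -> structured A \/ sparse x A.
Proof.
  intros HA Hi Hl Hn0 Hy0. pose proof HA as [Hx _].
  assert (Hor : forall n, A n -> cls A i n \/ nbr A i n).
  { intros n Hn. destruct (Nat.eq_dec (n mod 4) i) as [|Hne]; [left; now split|right].
    split; auto. rewrite <- Nat.Div0.add_mod_idemp_l.
    pose proof (Nat.mod_upper_bound n 4 ltac:(lia)).
    destruct (lt_4_cases (n mod 4) ltac:(lia)) as [E|[E|[E|E]]], Hi as [->| ->];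
      rewrite E in *; simpl; lia. }
  destruct (classic (9 | Z.of_nat n0)%Z) as [H9|H9].
  { left. right. left. intros n Hn. apply divide9_mod.
    assert (Hy9 : forall y, nbr A i y -> (9 | Z.of_nat y)%Z).
    { intros y Hy. apply (divide9_cancel n0 y); auto; now apply (Hl n0 y). }
    destruct (Hor n Hn) as [Hc|Hc]; auto.
    apply (divide9_cancel n y0); auto; now apply (Hl n y0). }
  assert (Hn9 : forall n, A n -> ~ (9 | Z.of_nat n)%Z).
  { intros n Hn H. apply H9.
    assert (Hy : (9 | Z.of_nat y0)%Z).
    { destruct (Hor n Hn) as [Hc|Hc].
      - apply (divide9_cancel n y0); auto; now apply (Hl n y0).
      - exfalso. apply H9. apply (divide9_cancel n0 n); auto; now apply (Hl n0 n). }
    apply (divide9_cancel n0 y0); auto; now apply (Hl n0 y0). }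
  assert (Hmono : mono 9 (nbr A i)).
  { intros a b Ha Hb. apply (hit_diff 9 n0); now apply (Hl n0). }
  destruct (classic (exists o, A o /\ Nat.Odd o)) as [[o [Ho Hoo]]|Hno].
  - right. apply (sparse_of_dens x A (fun j => if (j =? i)%nat then / 9 else 0.01024)).
    + lra.
    + intros j Hj. destruct (Nat.eqb_spec j i) as [->|Hji].
      * replace (/ 9) with (/ INR 9) by (rewrite INR_IZR_INZ; reflexivity).
        apply dens_mono_class; auto; [lia|now apply Zgcd_1_rel_prime|].
        now apply (locked_mono A i 9 y0).
      * destruct (classic (exists n, cls A j n)) as [[n Hn]|He];
          [|apply dens_empty; try lra; intros n Hn; apply He; eauto].
        assert (Hji4 : ((j + i) mod 4 <> 0)%nat).
        { destruct (lt_4_cases j Hj) as [E|[E|[E|E]]], Hi as [->| ->];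
            rewrite E in *; simpl; lia. }
        assert (Hsub : forall n, cls A j n -> nbr A i n) by (intros; now apply cls_nbr_iff with j).
        (* Neighbours of [i] are congruent modulo 9, so [n + o] is [2 n] modulo 9, which is not 0.
           For odd [j], [n] itself plays the part of [o]. *)
        assert (Hny : exists y, nbr A j y /\ ~ (9 | Z.of_nat n + Z.of_nat y)%Z).
        { destruct (Nat.Even_or_Odd j) as [Hje|Hjo].
          - exists o. assert (Hnbr : nbr A j o).
            { split; auto. destruct Hje as [k ->], Hoo as [k' ->]. intros H.
              pose proof (Nat.div_mod_eq (2 * k' + 1 + 2 * k) 4). lia. }
            split; auto. intros H.
            assert (Hio : nbr A i o).
            { destruct (Hor o Ho) as [[_ Hc]|]; auto. exfalso.
              pose proof (Nat.div_mod_eq o 4). destruct Hoo as [k' Hk']. lia. }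
            assert (Hd : (9 | Z.of_nat o - Z.of_nat n)%Z)
              by (apply Hmono; auto).
            apply (Hn9 n); [apply Hn|]. apply two_divide9.
            replace (Z.of_nat n + Z.of_nat n)%Z
              with ((Z.of_nat n + Z.of_nat o) - (Z.of_nat o - Z.of_nat n))%Z by lia.
            now apply Z.divide_sub_r.
          - exists n. split.
            + apply cls_self_nbr; auto. destruct Hjo as [k Hk].
              pose proof (Nat.div_mod_eq j 2). pose proof (Nat.mod_upper_bound j 2). lia.
            + intros H. apply (Hn9 n); [apply Hn|]. now apply two_divide9. }
        destruct Hny as [y [Hy Hyn]].
        apply (small_class_9 x A j n y); auto. intros a b Ha Hb. apply Hmono; auto.
    + destruct Hi as [->| ->]; simpl; lra.
  - left.
    assert (He : forall n, A n -> Nat.Even n).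
    { intros n Hn. destruct (Nat.Even_or_Odd n); auto. exfalso. eauto. }
    assert (Hy0c : cls A (2 - i) y0).
    { destruct Hy0 as [Hy0 Hy0m]. split; auto.
      destruct (He y0 Hy0) as [k Hk]. rewrite <- Nat.Div0.add_mod_idemp_l in Hy0m.
      pose proof (Nat.mod_upper_bound y0 4 ltac:(lia)). pose proof (Nat.div_mod_eq y0 4).
      destruct (lt_4_cases (y0 mod 4) ltac:(lia)) as [E|[E|[E|E]]], Hi as [->| ->];
        rewrite E in *; simpl in *; lia. }
    destruct Hi as [->| ->]; simpl in Hy0c.
    + apply (even_classes_structured A n0 y0); auto; [|apply Hn9, Hy0].
      intros n m Hn Hm. apply (Hl n m); auto. apply cls_nbr_iff with 2%nat; [exact Hm|simpl; lia].
    + apply (even_classes_structured A y0 n0); auto.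
      intros n m Hn Hm. rewrite Z.add_comm. apply (Hl m n); auto.
      apply cls_nbr_iff with 0%nat; [exact Hn|simpl; lia].
Qed.

(** An odd class is its own neighbour, so [9 | 2 n] and hence 9 divides the class and all its
    neighbours. Only the class [4 - i] can escape; an element [w] of it not divisible by 9 makes
    both even classes thin, and the total is at most [1/9 + 0.04666 + 2 * 0.01024]. *)
Lemma locked_odd (x : R) (A : nat -> Prop) (i n0 : nat) :
  sqfree_avoiding x A -> (i = 1 \/ i = 3)%nat -> locked A i ->
  cls A i n0 -> structured A \/ sparse x A.
Proof.
  intros HA Hi Hl Hn0. pose proof HA as [Hx _].
  assert (Hself : forall n, cls A i n -> nbr A i n)
    by (intros n; apply cls_self_nbr; destruct Hi as [->| ->]; reflexivity).
  assert (Hi9 : forall n, cls A i n -> (9 | Z.of_nat n)%Z).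
  { intros n Hn. apply two_divide9. apply (Hl n n); auto. }
  assert (Hy9 : forall y, nbr A i y -> (9 | Z.of_nat y)%Z).
  { intros y Hy. apply (divide9_cancel n0 y); [now apply (Hl n0 y)|auto]. }
  assert (Hj : forall n, A n -> nbr A i n \/ cls A (4 - i) n).
  { intros n Hn. destruct (Nat.eq_dec ((n + i) mod 4) 0) as [E|E]; [right|left; now split].
    split; auto. rewrite <- Nat.Div0.add_mod_idemp_l in E.
    pose proof (Nat.mod_upper_bound n 4 ltac:(lia)).
    destruct (lt_4_cases (n mod 4) ltac:(lia)) as [E'|[E'|[E'|E']]], Hi as [->| ->];
      rewrite E' in *; simpl in *; lia. }
  destruct (classic (exists w, cls A (4 - i) w /\ ~ (9 | Z.of_nat w)%Z)) as [[w [Hw Hw9]]|Hno].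
  2:{ left. right. left. intros n Hn. apply divide9_mod.
      destruct (Hj n Hn) as [H|H]; auto. apply NNPP. intros H9. apply Hno. eauto. }
  right.
  apply (sparse_of_dens x A (fun j => if (j =? i)%nat then / 9 else
    if (j =? 4 - i)%nat then 0.04666 else 0.01024)).
  - lra.
  - intros j Hj4. destruct (Nat.eqb_spec j i) as [->|Hji].
    { replace (/ 9) with (/ INR 9) by (rewrite INR_IZR_INZ; reflexivity).
      apply dens_mono_class; auto; [lia|now apply Zgcd_1_rel_prime|].
      apply (locked_mono A i 9 n0); auto. }
    destruct (Nat.eqb_spec j (4 - i)) as [->|Hji'].
    + assert (Hjself : forall n, cls A (4 - i) n -> nbr A (4 - i) n)
        by (intros n; apply cls_self_nbr; destruct Hi as [->| ->]; reflexivity).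
      destruct (classic (mono 9 (cls A (4 - i)))) as [Hm|Hm].
      * eapply dens_le; [lra| |].
        -- apply (small_class_9 x A (4 - i) w w); auto. intros H. now apply Hw9, two_divide9.
        -- lra.
      (* The second alternative bounds the classes of neighbours, and the odd class [4 - i] is one
         of them. *)
      * destruct (dens_nbr_not_mono x A (4 - i)) as [H|[_ H]]; auto.
        -- intros H. apply Hm. intros a b Ha Hb. apply H; auto.
        -- eapply dens_le; [lra|apply H|lra]. destruct Hi as [->| ->]; simpl; lia.
    + destruct (classic (exists n, cls A j n)) as [[n Hn]|He];
        [|apply dens_empty; try lra; intros n Hn; apply He; eauto].
      assert (Hje : (j = 0 \/ j = 2)%nat) by lia.
      assert (Hji4 : ((j + i) mod 4 <> 0)%nat)
        by (destruct Hje as [->| ->], Hi as [->| ->]; simpl; lia).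
      assert (Hsub : forall n, cls A j n -> (9 | Z.of_nat n)%Z)
        by (intros; apply Hy9; now apply cls_nbr_iff with j).
      apply (small_class_9 x A j n w); auto.
      * intros a b Ha Hb. apply Z.divide_sub_r; apply Hsub; auto.
      * apply cls_nbr_iff with (4 - i)%nat; auto.
        destruct Hje as [->| ->], Hi as [->| ->]; simpl; lia.
      * intros H. apply Hw9. now apply (divide9_cancel n w); auto.
  - destruct Hi as [->| ->]; simpl; lra.
Qed.

Lemma unlocked_mono_class (x : R) (A : nat -> Prop) (j : nat) :
  sqfree_avoiding x A -> ~ locked A j -> mono 9 (cls A j) -> dens x A j 0.01024.
Proof.
  intros HA Hl Hm.
  apply not_all_ex_not in Hl. destruct Hl as [n Hl].
  apply not_all_ex_not in Hl. destruct Hl as [y Hl].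
  apply imply_to_and in Hl. destruct Hl as [Hn Hl].
  apply imply_to_and in Hl. destruct Hl as [Hy Hl].
  now apply (small_class_9 x A j n y).
Qed.

Lemma exists_least (P : nat -> Prop) : (exists n, P n) ->
  exists n, P n /\ forall m, (m < n)%nat -> ~ P m.
Proof.
  intros [n Hn]. revert Hn. induction n as [n IH] using lt_wf_ind. intros Hn.
  destruct (classic (exists m, (m < n)%nat /\ P m)) as [[m [Hm HPm]]|Hno]; [eauto|].
  exists n. split; auto. intros m Hm HPm. apply Hno. eauto.
Qed.

(** Elements of the class are [16 q^2] apart by [square_gap], and [x / (16 q^2)] is [x / 4] times
    [1 / (4 q^2)]. *)
Lemma dens_separated (x : R) (A : nat -> Prop) (j q : nat) (Q : nat -> Prop) :
  sqfree_avoiding x A -> (7 <= q)%nat -> (forall n, cls A j n -> Q n) ->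
  (forall p, nprime p -> (3 <= p < q)%nat -> mono (p * p) Q) ->
  dens x A j (inv_sq q / 4).
Proof.
  intros [Hx [Hb _]] Hq HQ Hm.
  eapply card_le_mono; [apply (card_le_sep (cls A j) x (16 * (q * q)))|auto|].
  - nia.
  - lra.
  - intros n [Hn _]. now apply Hb.
  - intros n n' Hn Hn' Hlt.
    assert (16 * Z.of_nat (q * q) <= Z.of_nat n' - Z.of_nat n)%Z; [|lia].
    apply square_gap; [exact Hq|lia| |].
    + destruct Hn, Hn'. change 4%Z with (Z.of_nat 4). now apply mod4_cong with j.
    + intros p Hp H2 Hpq. pose proof (nprime_pos p Hp). apply Hm; auto; lia.
  - assert (0 < INR q) by (apply lt_0_INR; lia).
    rewrite !mult_INR. replace (INR 16) with 16 by (rewrite INR_IZR_INZ; reflexivity).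
    unfold inv_sq. pose proof (err_ge x). pose proof (root_bound_nonneg x).
    replace (x / (16 * (INR q * INR q))) with (x / 4 * (/ (INR q * INR q) / 4)) by (field; lra).
    lra.
Qed.

(* The class [i] is large and all other classes together are thin: with [q] the
   least prime such that the other classes meet two residues modulo [q^2], the
   gain [3 / (4 q^2)] of the other classes is at most the loss of the class [i]. *)
Lemma star_bound (x : R) (A : nat -> Prop) (i y0 Q0 : nat) (B : R) :
  sqfree_avoiding x A -> (i = 0 \/ i = 2)%nat -> (7 <= Q0)%nat ->
  nbr A i y0 -> mono 9 (nbr A i) ->
  (forall j, (j < 4)%nat -> j <> i -> dens x A j 0.01024) ->
  (forall b, nbr A i b -> card_le (odd_square_shift x b i) B) ->
  card_le A (B + x * inv_sq Q0 + 4 * err x).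
Proof.
  intros HA Hi HQ0 Hy0 Hm Hd HB. pose proof HA as [Hx _].
  assert (Hsub : forall j n, (j < 4)%nat -> j <> i -> cls A j n -> nbr A i n).
  { intros j n Hj Hji Hn. apply cls_nbr_iff with j; auto.
    destruct (lt_4_cases j Hj) as [E|[E|[E|E]]], Hi as [->| ->];
      rewrite E in *; simpl; lia. }
  assert (Hcomb : forall (Bi r : R), card_le (cls A i) Bi ->
     (forall j, (j < 4)%nat -> j <> i -> dens x A j r) ->
     card_le A (Bi + 3 * (x / 4 * r + err x))).
  { intros Bi r HBi Hr.
    eapply card_le_mono;
      [apply (card_le_total x A (fun j => if (j =? i)%nat then Bi else x / 4 * r + err x))|auto|].
    - intros j Hj. destruct (Nat.eqb_spec j i) as [->|Hji]; auto. now apply Hr.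
    - destruct Hi as [->| ->]; simpl; lra. }
  pose proof (inv_sq_nonneg Q0). pose proof (err_ge x). pose proof (root_bound_nonneg x).
  destruct (classic (exists q, nprime q /\ (3 <= q < Q0)%nat /\ ~ mono (q * q) (nbr A i)))
    as [Hex|Hno].
  - apply exists_least in Hex. destruct Hex as [q [[Hq [Hq3 Hqm]] Hleast]].
    assert (Hq3' : q <> 3%nat) by (intros ->; now apply Hqm).
    assert (Hq4 : q <> 4%nat).
    { intros ->. apply (nprime_not_composite 4 2 Hq); [lia|]. now exists 2%Z. }
    assert (Hq6 : q <> 6%nat).
    { intros ->. apply (nprime_not_composite 6 2 Hq); [lia|]. now exists 3%Z. }
    destruct (two_residues _ _ _ Hqm Hqm) as [b [b' [Hb [Hb' [Hbb _]]]]].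
    assert (Hloss := two_shift_loss x A i q b b' B HA Hq ltac:(lia) ltac:(lia) Hb Hb' Hbb (HB b Hb)).
    pose proof (inv_sq_nonneg q).
    (* The spacing bound starts at 7. For 5 the density 0.01024 is enough:
       [3 * 0.01024 < 0.7967 / 25]. *)
    destruct (Nat.eq_dec q 5) as [->|Hq5].
    + eapply card_le_mono; [apply (Hcomb _ 0.01024 Hloss Hd)|auto|].
      assert (inv_sq 5 = 0.04) by (unfold inv_sq; rewrite INR_IZR_INZ; simpl; lra). nra.
    + assert (Hsep : forall j, (j < 4)%nat -> j <> i -> dens x A j (inv_sq q / 4)).
      { intros j Hj Hji. apply (dens_separated x A j q (nbr A i));
          [exact HA|lia|intros n; now apply (Hsub j)|].
        intros p Hp Hpq. apply NNPP. intros Hpm. apply (Hleast p); [lia|].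
        split; auto. split; auto; lia. }
      eapply card_le_mono; [apply (Hcomb _ _ Hloss Hsep)|auto|]. nra.
  (* No prime below the cutoff [Q0] yields a loss, but then the other classes together have at most
     about [3 x / (16 Q0^2)] elements. *)
  - assert (Hsep : forall j, (j < 4)%nat -> j <> i -> dens x A j (inv_sq Q0 / 4)).
    { intros j Hj Hji. apply (dens_separated x A j Q0 (nbr A i));
        [exact HA|exact HQ0|intros n; now apply (Hsub j)|].
      intros p Hp Hpq. apply NNPP. intros Hpm. apply Hno. eauto. }
    eapply card_le_mono; [apply (fun H => Hcomb B _ H Hsep)|auto|].
    + eapply card_le_mono; [exact (HB y0 Hy0)| |apply Rle_refl].
      intros n Hn. now apply nbr_odd_square_shift with A.
    + nra.
Qed.

Lemma structured_or_small (x : R) (A : nat -> Prop) (Q0 : nat) (B : R) :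
  sqfree_avoiding x A -> (7 <= Q0)%nat ->
  (forall i b, nbr A i b -> card_le (odd_square_shift x b i) B) ->
  structured A \/ sparse x A \/ card_le A (B + x * inv_sq Q0 + 4 * err x).
Proof.
  intros HA HQ0 HB. pose proof HA as [Hx _].
  destruct (classic (structured A)) as [|Hst]; auto. right.
  (* If a nonempty class has no neighbour, all of [A] lies in the class [-i], hence in the class 0
     or 2 modulo 4, which is structured. *)
  assert (Hne : forall i, (i < 4)%nat -> (exists n, cls A i n) -> exists y, nbr A i y).
  { intros i Hi [n Hn]. apply NNPP. intros Hno.
    assert (Hall : forall y, A y -> ((y + i) mod 4 = 0)%nat).
    { intros y Hy. apply NNPP. intros H. apply Hno. exists y. now split. }
    pose proof (Hall n (proj1 Hn)) as Hni. destruct Hn as [Hn Hnc].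
    apply Hst. unfold structured.
    assert (Hi2 : (i = 0 \/ i = 2)%nat).
    { rewrite <- Nat.Div0.add_mod_idemp_l, Hnc in Hni.
      destruct (lt_4_cases i Hi) as [E|[E|[E|E]]]; rewrite E in *; simpl in *; lia. }
    destruct Hi2 as [->| ->]; [left|right; right; left]; intros y Hy;
      specialize (Hall y Hy); [now rewrite Nat.add_0_r in Hall|].
    pose proof (Nat.div_mod_eq (y + 2) 4). pose proof (Nat.div_mod_eq y 4).
    pose proof (Nat.mod_upper_bound y 4). lia. }
  destruct (classic (exists i, (i < 4)%nat /\ (exists n, cls A i n) /\ locked A i))
    as [[i [Hi [[n Hn] Hl]]]|Hnl].
  { left. destruct (Hne i Hi (ex_intro _ n Hn)) as [y Hy].
    assert (Hc : (i = 0 \/ i = 2)%nat \/ (i = 1 \/ i = 3)%nat) by lia.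
    destruct Hc as [Hc|Hc].
    - destruct (locked_even x A i n y HA Hc Hl Hn Hy); tauto.
    - destruct (locked_odd x A i n HA Hc Hl Hn); tauto. }
  assert (Hmono : forall j, (j < 4)%nat -> mono 9 (cls A j) -> dens x A j 0.01024).
  { intros j Hj Hm. destruct (classic (exists n, cls A j n)) as [He|He].
    - apply unlocked_mono_class; auto. intros H. apply Hnl. eauto.
    - apply dens_empty; try lra. intros n Hn. apply He. eauto. }
  destruct (classic (exists i, (i < 4)%nat /\ ~ mono 9 (cls A i) /\ mono 9 (nbr A i)))
    as [[i [Hi [Hm Hmn]]]|Hnx].
  - right.
    (* An odd class lies among its own neighbours, so it cannot meet two residues modulo 9 when they
       do not. *)
    assert (Hi2 : (i = 0 \/ i = 2)%nat).
    { assert (Hc : (i = 0 \/ i = 2)%nat \/ (i mod 2 = 1)%nat)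
        by (destruct (lt_4_cases i Hi) as [E|[E|[E|E]]]; rewrite E; auto).
      destruct Hc as [|Hc]; auto. exfalso. apply Hm. intros a b Ha Hb.
      apply Hmn; now apply cls_self_nbr. }
    destruct (two_residues _ _ _ Hm Hm) as [n [_ [Hn _]]].
    destruct (Hne i Hi (ex_intro _ n Hn)) as [y Hy].
    apply (star_bound x A i y Q0 B); auto.
    intros j Hj Hji. apply Hmono; auto. intros a b Ha Hb. apply Hmn.
    + apply cls_nbr_iff with j; auto.
      destruct (lt_4_cases j Hj) as [E|[E|[E|E]]], Hi2 as [->| ->];
        rewrite E in *; simpl; lia.
    + apply cls_nbr_iff with j; auto.
      destruct (lt_4_cases j Hj) as [E|[E|[E|E]]], Hi2 as [->| ->];
        rewrite E in *; simpl; lia.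
  - left.
    assert (Hdich : forall i, (i < 4)%nat -> dens x A i 0.04666 \/
      (dens x A i 0.0921 /\ forall j, ((j + i) mod 4 <> 0)%nat -> dens x A j 0.00814)).
    { intros i Hi. destruct (classic (mono 9 (cls A i))) as [Hm|Hm].
      - left. eapply dens_le; [lra|now apply Hmono|lra].
      - apply dens_nbr_not_mono; auto. intros H. apply Hnx. eauto. }
    destruct (classic (exists i, (i = 0 \/ i = 2)%nat /\ dens x A i 0.0921 /\
      forall j, ((j + i) mod 4 <> 0)%nat -> dens x A j 0.00814)) as [[i [Hi [Hd Hd']]]|Hno].
    + apply (sparse_of_dens x A (fun j => if (j =? i)%nat then 0.0921 else 0.00814)).
      * lra.
      * intros j Hj. destruct (Nat.eqb_spec j i) as [->|Hji]; auto. apply Hd'.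
        destruct (lt_4_cases j Hj) as [E|[E|[E|E]]], Hi as [->| ->];
          rewrite E in *; simpl; lia.
      * destruct Hi as [->| ->]; simpl; lra.
    (* The second alternative is now possible only for an odd class, which is its own neighbour and
       so has density at most 0.00814. *)
    + apply (sparse_of_dens x A (fun _ => 0.04666)); [lra| |lra].
      intros j Hj. destruct (Hdich j Hj) as [|[Hd Hd']]; auto.
      assert (Hc : (j = 0 \/ j = 2)%nat \/ (j = 1 \/ j = 3)%nat) by lia.
      destruct Hc as [Hc|Hc]; [exfalso; eauto|].
      eapply dens_le; [lra|apply Hd'|lra]. destruct Hc as [->| ->]; simpl; lia.
Qed.

(** * Fitting the error terms into epsilon *)

Theorem theorem1 :
  forall eps : R, eps > 0 ->
  exists x0 : R, forall x : R, x > x0 ->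
  forall A : list nat,
    NoDup A ->
    (forall n, In n A -> (1 <= n)%nat /\ INR n <= x) ->
    sumset_no_squarefree A ->
    INR (length A) > (delta0 + eps) * x ->
    (forall n, In n A -> n mod 4 = 0)%nat \/
    (forall n, In n A -> n mod 9 = 0)%nat \/
    (forall n, In n A -> n mod 4 = 2)%nat \/
    ((forall n, In n A -> Nat.Even n) /\
     exists a : nat, (1 <= a <= 8)%nat /\
       forall n, In n A ->
         (n mod 4 = 2 <-> n mod 9 = a)%nat /\
         (n mod 4 = 0 <-> (n + a) mod 9 = 0)%nat).
Proof.
  intros eps Heps.
  (* One quarter of [eps] each goes to the density of the shifts, to [4 * err x] (whence
     [48000 = 4 * 12000]) and to [1 / Q0^2]. *)
  destruct (odd_square_shift_density (eps / 4)) as [x1 Hx1]; [lra|].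
  destruct (root_bound_negligible 48000 (eps / 4)) as [x2 [Hx2 Herr]]; [lra|lra|].
  (* [Q0^2 >= Q0 >= 4 / eps]; adding 7 meets the lower bound required of the cutoff. *)
  destruct (INR_unbounded (4 / eps)) as [Q1 HQ1].
  set (Q0 := (Q1 + 7)%nat).
  exists (Rmax x1 x2). intros x Hx A HND Hrange Hsum Hlen.
  assert (x1 < x) by (eapply Rle_lt_trans; [apply Rmax_l|exact Hx]).
  assert (x2 < x) by (eapply Rle_lt_trans; [apply Rmax_r|exact Hx]).
  specialize (Herr x ltac:(lra)).
  assert (HA : sqfree_avoiding x (fun n => In n A)) by (split; [lra|split; auto]).
  assert (Hd0 : delta0 = eta / 4) by (unfold delta0, eta; field; apply PI_neq0).
  assert (He4 : 4 * err x <= eps / 4 * x) by (unfold err; lra).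
  destruct (structured_or_small x (fun n => In n A) Q0 ((eta / 4 + eps / 4) * x))
    as [H1|[H2|H2]]; auto.
  - unfold Q0; lia.
  - intros i b [Hb Hbi]. apply Hx1; auto. now apply Hrange.
  - exfalso. specialize (H2 A HND (fun _ h => h)). pose proof eta_lower.
    rewrite Hd0 in Hlen. nra.
  - exfalso. specialize (H2 A HND (fun _ h => h)).
    assert (HQ : inv_sq Q0 <= eps / 4).
    { assert (0 < 4 / eps) by (apply Rdiv_lt_0_compat; lra).
      assert (Hq1 : 1 <= INR Q0) by (change 1 with (INR 1); apply le_INR; unfold Q0; lia).
      assert (Hq2 : 4 / eps <= INR Q0).
      { apply Rle_trans with (INR Q1); [lra|]. apply le_INR. unfold Q0. lia. }
      unfold inv_sq. replace (eps / 4) with (/ (4 / eps)) by (field; lra).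
      apply Rinv_le_contravar; auto. nra. }
    rewrite Hd0 in Hlen. nra.
Qed.
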